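(* The Hilbert operator $H$ maps the Banach space $\mathcal{F}(\mathbb{R})$ onto $\mathcal{F}(\mathbb{R})$. It is an isometric operator. Every function $\varphi\in\mathcal{F}(\mathbb{R})$ that is the Fourier transform of a function $f\in L_1(-\infty,\infty)$ equal to zero on one of the half-axes $(-\infty,0)$, $(0,\infty)$ is an eigenfunction of $H$. Every function in $\mathcal{F}(\mathbb{R})$ can be represented as a sum of two eigenfunctions of $H$.
   Context: $\mathcal{F}(\mathbb{R})$ is the set of all functions $\widehat f(x)=\frac{1}{\sqrt{2\pi}}\int_{-\infty}^{\infty}f(t)e^{-ixt}\,dt$ with $f\in L_1(-\infty,\infty)$, with the norm $\|\widehat f\|=\frac{1}{\sqrt{2\pi}}\|f\|_{L_1}$. The Hilbert transform is $$(H\varphi)(x)=\mathrm{V.P.}\frac1\pi\int_{-\infty}^\infty\frac{\varphi(t)}{x-t}\,dt=\lim_{\varepsilon\to+0,\ N\to\infty}\frac1\pi\left(\int_{-N}^{x-\varepsilon}\frac{\varphi(t)}{x-t}\,dt+\int_{x+\varepsilon}^{N}\frac{\varphi(t)}{x-t}\,dt\right).$$ An eigenfunction of $H$ is a function $\varphi$ with $H\varphi=\lambda\varphi$ for some constant $\lambda\in\mathbb{C}$ (the zero function is allowed). *)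

(* Defs.v *)
From HB Require Import structures.
From mathcomp Require Import all_boot all_order all_algebra.
From mathcomp Require Import all_classical all_reals all_analysis.
From mathcomp Require Import complex.

Set Implicit Arguments.
Unset Strict Implicit.
Unset Printing Implicit Defensive.

Import Order.TTheory GRing.Theory Num.Theory.
Import numFieldNormedType.Exports.

Local Open Scope classical_set_scope.
Local Open Scope ring_scope.
Local Open Scope complex_scope.

Section FourierHilbert.
Context {R : realType}.
Let mu := @lebesgue_measure R.

Definition cintegrable (D : set R) (f : R -> R[i]) : Prop :=
  mu.-integrable D (fun t => (complex.Re (f t))%:E) /\
  mu.-integrable D (fun t => (complex.Im (f t))%:E).

Definition cintegral (D : set R) (f : R -> R[i]) : R[i] :=
  (\int[mu]_(t in D) complex.Re (f t)) +i* (\int[mu]_(t in D) complex.Im (f t)).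

Definition expi (a : R) : R[i] := cos a +i* sin a.

(* L_1(-oo, +oo): functions themselves, not classes modulo a.e. equality. *)
Definition L1 : set (R -> R[i]) := [set f | cintegrable setT f].

(* [Normc.normc] is the modulus with values in [R]; [`| z |] lives in [R[i]]. *)
Definition L1norm (f : R -> R[i]) : R := \int[mu]_(t in setT) Normc.normc (f t).

Definition fourier (f : R -> R[i]) (x : R) : R[i] :=
  ((Num.sqrt (2 * pi))^-1)%:C * cintegral setT (fun t => f t * expi (- (x * t))).

Definition FR : set (R -> R[i]) := fourier @` L1.

(* The norm of [phi] is read off from a chosen L_1 function whose transform is
   [phi]; the choice is immaterial because the Fourier transform determines
   such a function up to a null set. Only meaningful on [FR]. *)
Definition FRnorm (phi : R -> R[i]) : R :=
  (Num.sqrt (2 * pi))^-1 *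
  L1norm (xget (fun=> 0) [set f | L1 f /\ fourier f = phi]).

Definition hilbert_kernel (phi : R -> R[i]) (x t : R) : R[i] :=
  phi t / (x - t)%:C.

Definition hilbert_trunc (phi : R -> R[i]) (x eps N : R) : R[i] :=
  (pi^-1)%:C * (cintegral `[- N, x - eps] (hilbert_kernel phi x) +
                cintegral `[x + eps, N] (hilbert_kernel phi x)).

(* [R[i]^o] is [R[i]] with the topology of its modulus. The limit is the joint
   one: eps -> +0 and N -> +oo independently of each other. *)
Definition hilbert_filter (phi : R -> R[i]) (x : R) : set_system R[i]^o :=
  (fun p : R * R => hilbert_trunc phi x p.1 p.2 : R[i]^o) @
    filter_prod (0 : R)^'+ (pinfty_nbhs R).

(* [lim] and [cintegral] are total, so the existence of the truncated integrals
   and of their limit, at every point [x], is a separate predicate. *)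
Definition hilbert_exists (phi : R -> R[i]) : Prop :=
  forall x : R,
    (forall eps N : R, 0 < eps ->
       cintegrable `[- N, x - eps] (hilbert_kernel phi x) /\
       cintegrable `[x + eps, N] (hilbert_kernel phi x)) /\
    cvg (hilbert_filter phi x).

Definition hilbert (phi : R -> R[i]) : R -> R[i] :=
  fun x => lim (hilbert_filter phi x).

Definition hilbert_eigenfunction (phi : R -> R[i]) : Prop :=
  hilbert_exists phi /\
  exists lambda : R[i], forall x, hilbert phi x = lambda * phi x.

(* A linear operator on [FR] that preserves the norm. *)
Definition isometric_operator (T : (R -> R[i]) -> (R -> R[i])) : Prop :=
  (forall (a b : R[i]) (phi psi : R -> R[i]), FR phi -> FR psi ->
     T (fun x => a * phi x + b * psi x) = (fun x => a * T phi x + b * T psi x)) /\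
  (forall phi, FR phi -> FRnorm (T phi) = FRnorm phi).

End FourierHilbert.

Arguments L1 : clear implicits.
Arguments FR : clear implicits.

(* Main.v *)
Require Import Defs.
From HB Require Import structures.
From mathcomp Require Import all_boot all_order all_algebra.
From mathcomp Require Import all_classical all_reals all_analysis.
From mathcomp Require Import complex.
From mathcomp Require Import measurable_realfun ring lra.
Set Implicit Arguments.
Unset Strict Implicit.
Unset Printing Implicit Defensive.
Import Order.TTheory GRing.Theory Num.Theory.
Import numFieldNormedType.Exports.
Local Open Scope classical_set_scope.
Local Open Scope ring_scope.
Local Open Scope complex_scope.

(* The truncated Hilbert transform of exp(- i s t), as a function of s, is
   bounded uniformly in t and tends to i sgn(t) exp(- i x t): this is the
   Dirichlet integral. By Fubini and dominated convergence,
   H(f^) = (i sgn f)^ for f in L_1, which gives surjectivity, the eigenfunctions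
   (with eigenvalues i and - i) and the decomposition f = f 1_{t >= 0} + f 1_{t < 0}.
   Isometry also needs f^ to determine f. That follows from the same formula:
   if f^ = 0, then the translates of f have zero transform too, so the integral
   of sgn(t - a) f(t) vanishes for every a, hence so does the integral of f over
   every half-line, and f = 0 a.e. by Lebesgue differentiation. *)

(** * Dominated convergence along countably generated filters *)

(** The function sin u / u is not absolutely integrable on a half-line, so its tail is not directly
    a Lebesgue integral. It is replaced by a Laplace-type integral over s >= 0 whose integrand is
    bounded by 2 / (1 + s^2) for every v >= 0; the uniform bound pi and the limits pi / 2 at 0+ and
    0 at +oo all come from this one majorant. Uniformity in the frequency is what lets a constant
    times |f| dominate the outer integral. The two sides of the hole around x contribute 2 * (pi /
    2) = pi, which cancels the 1 / pi in H, so the multiplier has modulus 1: hence the isometry. The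
    cosine part survives truncation because [-N, N] is not centred at x, but it is O(|x| / N),
    uniformly in the frequency. The analysis is done on real functions: an amplitude p + i q is the
    pair (p, q), and the imaginary part of its transform is the real part for the pair (q, -p), so
    each real statement is applied twice. Since i sgn t is 0 at t = 0, the algebra of the multiplier
    holds only off a null set, which is enough for transforms and for norms. *)

Section countable_basis.
Context {R : realType}.

(* This countability lets the sequential dominated convergence theorem act on
   the joint limit [eps -> 0+], [N -> +oo]. *)
Definition has_nested_basis {U : Type} (F : set_system U) : Prop :=
  exists B : nat -> set U,
    [/\ forall n, F (B n), forall m n, (m <= n)%N -> B n `<=` B m
      & forall A, F A -> exists n, B n `<=` A].

Lemma at_right_nested_basis (a : R) : has_nested_basis a^'+.
Proof.
exists (fun n => [set x | a < x < a + n.+1%:R^-1]); split.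
- by move=> n; near=> x; apply/andP; split; [|near: x; apply: nbhs_right_lt;
    rewrite ltrDl invr_gt0].
- move=> m n mn x /= /andP[-> /lt_le_trans->]//.
  by rewrite lerD2l lef_pV2 ?posrE// ler_nat.
- move=> A [e /= e0 eA].
  have [n _ /(_ n (leqnn n)) /= en] := near_infty_natSinv_lt (PosNum e0).
  exists n => x /= /andP[ax xa]; apply: eA => //=.
  by rewrite ltr_distlC (lt_trans _ ax) ?ltrBlDr ?ltrDl// (lt_trans xa)// ltrD2l.
Unshelve. all: by end_near. Qed.

Lemma pinfty_nested_basis : has_nested_basis (pinfty_nbhs R).
Proof.
exists (fun n => [set x | n%:R < x]); split.
- by move=> n; exact: nbhs_pinfty_gt.
- by move=> m n mn x /=; apply: le_lt_trans; rewrite ler_nat.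
- move=> A [M [_ MA]]; have [n Mn] : exists n : nat, M < n%:R.
    by exists (Num.bound `|M|); apply: le_lt_trans (ler_norm M) _; exact: archi_boundP.
  by exists n => x /= nx; apply: MA; exact: lt_trans nx.
Qed.

Lemma filter_prod_nested_basis {U V : Type} (F : set_system U)
    (G : set_system V) : has_nested_basis F -> has_nested_basis G ->
  has_nested_basis (filter_prod F G).
Proof.
move=> [B [FB Bn BF]] [C [GC Cn CG]].
exists (fun n => B n `*` C n); split.
- by move=> n; exists (B n, C n); [split; [exact: FB|exact: GC]|].
- by move=> m n mn [u v] [/= Bu Cv]; split; [exact: Bn Bu|exact: Cn Cv].
- move=> A [[P Q] [/= /BF[m BP] /CG[n CQ]] PQA].
  exists (maxn m n) => -[u v] [/= Bu Cv]; apply: PQA; split => /=.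
    by apply/BP/(Bn _ _ _ _ Bu)/leq_maxl.
  by apply/CQ/(Cn _ _ _ _ Cv)/leq_maxr.
Qed.

(** If the integrals stayed at distance [e] from the limit along [F], one bad index could be picked
    in each basis set; these indices form a sequence tending to [F], which contradicts sequential
    dominated convergence. *)
Lemma dominated_cvg_nested_basis d (T : measurableType d)
    (mu : {measure set T -> \bar R}) (D : set T) (U : Type) (F : set_system U)
    (f : U -> T -> R) (h g : T -> R) :
  Filter F -> has_nested_basis F -> measurable D ->
  (\forall u \near F, measurable_fun D (f u)) -> measurable_fun D h ->
  {ae mu, forall x, D x -> f u x @[u --> F] --> h x} ->
  mu.-integrable D (EFin \o g) ->
  (\forall u \near F, forall x, D x -> `|f u x| <= g x) ->
  \int[mu]_(x in D) f u x @[u --> F] --> \int[mu]_(x in D) h x.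
Proof.
move=> FF [B [FB Bn BF]] mD mf mh fh ig fg.
apply/cvgrPdist_lt => e e0; apply: contrapT => /= bad.
(* Measurability and domination hold only near [F]. Starting the sequence inside [B n0] makes them
   hold for all its terms. *)
have [n0 Bn0] : exists n, B n `<=` [set u | measurable_fun D (f u) /\
    forall x, D x -> `|f u x| <= g x] by apply: BF; exact: filterI.
have /choice[u_ u_P] : forall n, exists u, B (n0 + n)%N u /\
    e <= `|\int[mu]_(x in D) h x - \int[mu]_(x in D) f u x|.
  move=> n; apply: contrapT => /forallNP nu; apply: bad.
  apply: filterS (FB (n0 + n)%N) => u Bu; rewrite ltNge; apply/negP => eu.
  exact: (nu u).
have u_F : u_ n @[n --> \oo] --> F.
  move=> A /BF[n BA]; exists n => // m /= nm; apply: BA.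
  by apply: Bn (u_P m).1; rewrite (leq_trans nm)// leq_addl.
have u_0 n : B n0 (u_ n) by apply: Bn (u_P n).1; exact: leq_addr.
have mf_ n : measurable_fun D (fun x => (f (u_ n) x)%:E).
  by apply/measurable_EFinP; case: (Bn0 _ (u_0 n)).
have mh' : measurable_fun D (EFin \o h) by exact/measurable_EFinP.
have cvf : {ae mu, forall x, D x -> (f (u_ n) x)%:E @[n --> \oo] --> (h x)%:E}.
  apply: filterS fh => x /[apply] fx; apply: cvg_EFin; first exact: nearW.
  exact: cvg_comp u_F fx.
have bf : {ae mu, forall x n, D x -> (`|(f (u_ n) x)%:E| <= (EFin \o g) x)%E}.
  by apply: aeW => x n Dx; rewrite lee_fin; apply: (Bn0 _ (u_0 n)).2.
have [ih _ cv] := dominated_convergence mD mf_ mh' cvf ig bf.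
have {}cv : \int[mu]_(x in D) f (u_ n) x @[n --> \oo] --> \int[mu]_(x in D) h x.
  apply: fine_cvg; rewrite fineK; last exact: integrable_fin_num.
  apply: cv.
have /cvgrPdist_lt/(_ _ e0)[n _ /(_ n (leqnn n))/=] := cv.
by rewrite ltNge (u_P n).2.
Qed.

End countable_basis.

(** * The tail of the Dirichlet integral *)

Section sine_tail.
Context {R : realType}.
Notation mu := (@lebesgue_measure R).

(** This is the integral over u > v of exp(- u s) sin u, obtained by writing 1 / u as the integral
    of exp(- u s) over s > 0 and exchanging the two integrations. *)
Definition sine_tail_kernel (v s : R) : R :=
  expR (- (v * s)) * (s * sin v + cos v) / oneDsqr s.

(* [sine_tail v] is the integral of [sin u / u] over [u > v], written in a form
   whose integrand is absolutely integrable, uniformly in [v >= 0]. *)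
Definition sine_tail (v : R) : R :=
  \int[mu]_(s in `[0, +oo[) sine_tail_kernel v s.

Lemma normr_sin_le (v : R) : 0 <= v -> `|sin v| <= v.
Proof.
rewrite le_eqVlt => /predU1P[<-|v0]; first by rewrite sin0 normr0.
have [|c _] := @MVT R sin cos 0 v v0 (fun x _ => is_derive_sin x).
  by apply: continuous_subspaceT => x; exact: continuous_sin.
rewrite sin0 !subr0 => ->; rewrite normrM (gtr0_norm v0) ler_piMl ?(ltW v0)//.
exact: cos_max.
Qed.

Lemma oneDsqr_gt0 (s : R) : 0 < oneDsqr s.
Proof. exact: lt_le_trans ltr01 (oneDsqr_ge1 s). Qed.

(** The factor s in the numerator is absorbed by the exponential: |s sin v| <= v s and 1 + v s <=
    exp(v s). The resulting majorant does not depend on [v]. *)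
Lemma sine_tail_kernel_le (v s : R) : 0 <= v -> 0 <= s ->
  `|sine_tail_kernel v s| <= 2 * (oneDsqr s)^-1.
Proof.
move=> v0 s0; rewrite /sine_tail_kernel normrM (@ger0_norm _ (_^-1)).
  2: by rewrite invr_ge0 ltW ?oneDsqr_gt0.
rewrite ler_wpM2r ?invr_ge0 ?(ltW (oneDsqr_gt0 _))//.
rewrite normrM (ger0_norm (expR_ge0 _)) expRN -ler_pdivlMl ?invr_gt0 ?expR_gt0//.
rewrite invrK (le_trans (ler_normD _ _))//.
have := expR_ge1Dx (v * s); have := cos_max v.
have vs0 : 0 <= v * s by exact: mulr_ge0.
have : `|s * sin v| <= v * s.
  by rewrite normrM (ger0_norm s0) mulrC ler_wpM2r// normr_sin_le.
lra.
Qed.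

Lemma continuous_sine_tail_kernel (v : R) : continuous (sine_tail_kernel v).
Proof.
move=> s; apply: cvgM; last exact: continuous_oneDsqrV.
apply: cvgM.
  apply: continuous_comp; last exact: continuous_expR.
  by apply: cvgN; apply: cvgM; [exact: cvg_cst|exact: cvg_id].
by apply: cvgD; [apply: cvgM; [exact: cvg_id|exact: cvg_cst]|exact: cvg_cst].
Qed.

Lemma measurable_sine_tail_kernel (D : set R) (v : R) :
  measurable_fun D (sine_tail_kernel v).
Proof.
apply: measurable_funTS; apply: continuous_measurable_fun.
exact: continuous_sine_tail_kernel.
Qed.

Lemma integrable_oneDsqrV :
  mu.-integrable `[0, +oo[ (fun s => (2 * (oneDsqr s)^-1)%:E).
Proof.
suff: mu.-integrable `[0, +oo[ (fun s => ((oneDsqr s)^-1)%:E).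
  by move=> iV; exact: (integrableZl _ 2 iV).
apply/integrableP; split.
  apply/measurable_EFinP/measurable_funTS.
  by apply: continuous_measurable_fun; exact: continuous_oneDsqrV.
under eq_integral => s _.
  rewrite gee0_abs ?lee_fin ?invr_ge0 ?(ltW (oneDsqr_gt0 _))//.
  over.
by rewrite integral0y_oneDsqr ltry.
Qed.

Lemma integrable_sine_tail_kernel (v : R) : 0 <= v ->
  mu.-integrable `[0, +oo[ (EFin \o sine_tail_kernel v).
Proof.
move=> v0; apply: le_integrable integrable_oneDsqrV => //.
  by apply/measurable_EFinP; exact: measurable_sine_tail_kernel.
move=> s; rewrite /= in_itv/= andbT => s0; rewrite lee_fin.
by rewrite (le_trans (sine_tail_kernel_le v0 s0))// ler_norm.
Qed.

Lemma normr_sine_tail_le (v : R) : 0 <= v -> `|sine_tail v| <= pi.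
Proof.
move=> v0.
have := @le_normr_Rintegral _ _ R mu `[0, +oo[ _ (measurable_itv _) (integrable_sine_tail_kernel v0).
move=> /le_trans; apply.
apply: (@le_trans _ _ (\int[mu]_(s in `[0, +oo[) (2 * (oneDsqr s)^-1))).
  apply: le_Rintegral => //.
  - exact: integrable_norm (integrable_sine_tail_kernel v0).
  - exact: integrable_oneDsqrV.
  - by move=> s /=; rewrite in_itv/= andbT => s0; exact: sine_tail_kernel_le.
rewrite /Rintegral; under eq_integral do rewrite EFinM.
rewrite ge0_integralZl//=.
- by rewrite integral0y_oneDsqr/= mulrCA mulfV ?mulr1.
- apply/measurable_EFinP/measurable_funTS.
  by apply: continuous_measurable_fun; exact: continuous_oneDsqrV.
Qed.

(** Pointwise convergence is required only for s > 0: at s = 0 the kernel is cos v, which has no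
    limit as v tends to +oo, and {0} is a null set. *)
Lemma cvg_sine_tail (F : set_system R) (h : R -> R) : Filter F ->
  has_nested_basis F -> (\forall v \near F, 0 <= v) ->
  measurable_fun [set: R] h ->
  (forall s, 0 < s -> sine_tail_kernel v s @[v --> F] --> h s) ->
  sine_tail v @[v --> F] --> \int[mu]_(s in `[0, +oo[) h s.
Proof.
move=> FF BF F0 mh kh.
apply: (@dominated_cvg_nested_basis R _ _ mu `[0, +oo[ R F sine_tail_kernel h
  (fun s => 2 * (oneDsqr s)^-1)) => //.
- by apply: nearW => v; exact: measurable_sine_tail_kernel.
- exact: measurable_funTS.
- exists [set 0]; split; [exact: measurable_set1|exact: lebesgue_measure_set1|].
  move=> s /= /not_implyP[]; rewrite in_itv/= andbT => s0 nc.
  apply: contrapT => /eqP sN0; apply: nc; apply: kh.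
  by rewrite lt_neqAle eq_sym sN0.
- exact: integrable_oneDsqrV.
- apply: filterS F0 => v v0 s /=; rewrite in_itv/= andbT => s0.
  exact: sine_tail_kernel_le.
Qed.

Lemma cvgy_sine_tail : sine_tail v @[v --> +oo] --> 0.
Proof.
rewrite [X in _ --> X](_ : _ = \int[mu]_(s in `[0, +oo[) 0); last first.
  by rewrite Rintegral_cst// mul0r.
apply: cvg_sine_tail; [exact: pinfty_nested_basis|exact: nbhs_pinfty_ge| |].
  exact: measurable_cst.
move=> s s0.
apply/norm_cvg0P.
apply: (@squeeze_cvgr _ _ _ _ (cst 0) (fun v => expR (- (v * s)) * (s + 1))).
- apply: nearW => v /=; rewrite normr_ge0/= /sine_tail_kernel -mulrA normrM.
  rewrite (ger0_norm (expR_ge0 _)) ler_wpM2l ?expR_ge0// normrM.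
  rewrite (@ger0_norm _ (_^-1)) ?invr_ge0 ?(ltW (oneDsqr_gt0 _))//.
  apply: (@le_trans _ _ (`|s * sin v + cos v| * 1)).
    by rewrite ler_wpM2l//; exact: oneDsqrV_le1.
  rewrite mulr1 (le_trans (ler_normD _ _))// lerD ?cos_max// normrM.
  by rewrite (gtr0_norm s0) ler_piMr ?sin_max// ltW.
- exact: cvg_cst.
- rewrite -[X in _ --> X](mul0r (s + 1)); apply: cvgMl.
  apply: (cvg_comp (fun v => v * s) (fun v => expR (- v))); last exact: cvgr_expR.
  by apply: gt0_cvgMly => //; exact: cvg_id.
Qed.

(** At v = 0 the kernel becomes 1 / (1 + s^2), so the Dirichlet value is the arctangent integral. *)
Lemma cvg0_sine_tail : sine_tail v @[v --> 0^'+] --> pi / 2.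
Proof.
rewrite [X in _ --> X](_ : _ = \int[mu]_(s in `[0, +oo[) (oneDsqr s)^-1); last first.
  by rewrite /Rintegral integral0y_oneDsqr.
apply: cvg_sine_tail; [exact: at_right_nested_basis|exact: nbhs_right_ge| |].
  by apply: continuous_measurable_fun; exact: continuous_oneDsqrV.
move=> s s0; rewrite -[X in _ --> X]mul1r; apply: cvgMl; apply: cvg_at_right_filter.
rewrite -[X in _ --> X]mul1r; apply: cvgM.
  rewrite -[X in _ --> X]expR0 -[X in expR X]oppr0 -[X in - X](mul0r s).
  apply: continuous_comp; last exact: continuous_expR.
  by apply: cvgN; apply: cvgMl; exact: cvg_id.
suff: s * sin x + cos x @[x --> (0 : R)] --> s * sin 0 + cos 0.
  by rewrite sin0 cos0 mulr0 add0r.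
by apply: cvgD; [apply: cvgMr; exact: continuous_sin|exact: continuous_cos].
Qed.

Lemma is_derive_sine_tail_kernel (v s : R) :
  is_derive v 1 (sine_tail_kernel ^~ s) (- (expR (- (v * s)) * sin v)).
Proof.
rewrite /sine_tail_kernel.
apply: is_derive_eq; rewrite /GRing.scale/=.
rewrite /oneDsqr.
by field; apply: lt0r_neq0; exact: oneDsqr_gt0.
Qed.

Let cvg_expRNM (v : R) : 0 < v -> - v^-1 * expR (- (v * s)) @[s --> +oo] --> 0.
Proof.
move=> v0; rewrite -[X in _ --> X](mulr0 (- v^-1)); apply: cvgMr.
apply: (cvg_comp (fun s => v * s) (fun s => expR (- s))); last exact: cvgr_expR.
by apply: gt0_cvgMry => //; exact: cvg_id.
Qed.

Let is_derive_expRNM (v s : R) : 0 < v ->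
  is_derive s 1 (fun s => - v^-1 * expR (- (v * s))) (expR (- (v * s))).
Proof.
move=> v0; apply: is_derive_eq; rewrite /GRing.scale/=.
by field; rewrite gt_eqF.
Qed.

Let continuous_expRNM (v : R) : continuous (fun s => expR (- (v * s))).
Proof.
move=> s; apply: continuous_comp; last exact: continuous_expR.
by apply: cvgN; apply: cvgM; [exact: cvg_cst|exact: cvg_id].
Qed.

Lemma integral0y_expRNM (v : R) : 0 < v ->
  (\int[mu]_(s in `[0%R, +oo[) (expR (- (v * s)))%:E)%E = (v^-1)%:E.
Proof.
move=> v0.
rewrite (@ge0_continuous_FTC2y R _ (fun s => - v^-1 * expR (- (v * s))) 0 0).
- by rewrite mulr0 oppr0 expR0 mulr1 -EFinB sub0r opprK.
- by move=> s _; exact: expR_ge0.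
- by apply: continuous_subspaceT; exact: continuous_expRNM.
- exact: cvg_expRNM.
- by move=> s _; have [] := is_derive_expRNM s v0.
- apply: cvg_at_right_filter; apply: cvgMr; exact: continuous_expRNM.
- by move=> s _; rewrite derive1E; have [] := is_derive_expRNM s v0.
Qed.

Lemma integrable0y_expRNM (v : R) : 0 < v ->
  mu.-integrable `[0, +oo[ (fun s => (expR (- (v * s)))%:E).
Proof.
move=> v0; apply/integrableP; split.
  apply/measurable_EFinP/measurable_funTS.
  by apply: continuous_measurable_fun; exact: continuous_expRNM.
under eq_integral do rewrite gee0_abs ?lee_fin ?expR_ge0//.
by rewrite integral0y_expRNM// ltry.
Qed.

(** Differentiating the kernel in [v] removes its denominator and leaves - exp(- v s) sin v, whose
    integral over s is - sin v / v. *)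
Lemma is_derive_sine_tail (v : R) : 0 < v ->
  is_derive v 1 sine_tail (- (sin v / v)).
Proof.
move=> v0.
(* The neighbourhood of [v] stays away from 0, so that exp(- (v / 2) s) is an integrable majorant of
   the derivative on all of it. *)
have vI : `]v / 2, v + 1[%classic v by rewrite /= in_itv/=; lra.
have intf x : `]v / 2, v + 1[%classic x ->
    mu.-integrable `[0, +oo[ (EFin \o sine_tail_kernel x).
  rewrite /= in_itv/= => /andP[vx _]; apply: integrable_sine_tail_kernel; lra.
have derf (x s : R) : `]v / 2, v + 1[%classic x -> `[0, +oo[%classic s ->
    derivable (sine_tail_kernel ^~ s) x 1.
  by move=> _ _; have [] := is_derive_sine_tail_kernel x s.
have intG : mu.-integrable `[0, +oo[ (EFin \o (fun s => expR (- (v / 2 * s)))).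
  by apply: integrable0y_expRNM; rewrite divr_gt0.
have d1E x s : partial1of2 sine_tail_kernel x s = - (expR (- (x * s)) * sin x).
  by rewrite partial1of2E; have [] := is_derive_sine_tail_kernel x s.
have G_ub (x s : R) : `]v / 2, v + 1[%classic x -> `[0, +oo[%classic s ->
    `|partial1of2 sine_tail_kernel x s| <= expR (- (v / 2 * s)).
  rewrite /= !in_itv/= andbT => /andP[vx _] s0.
  rewrite d1E normrN normrM (ger0_norm (expR_ge0 _)).
  rewrite (@le_trans _ _ (expR (- (x * s))))//.
    by rewrite ler_piMr ?expR_ge0 ?sin_max.
  by rewrite ler_expR lerN2 ler_wpM2r// ltW.
have G0 (s : R) : 0 <= expR (- (v / 2 * s)) by exact: expR_ge0.
have m0y : measurable (`[0, +oo[ : set R) by exact: measurable_itv.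
apply: DeriveDef.
  exact: (@derivable_under_integral R _ _ mu _ _ m0y _ _ _ vI intf derf _ G0 intG G_ub).
rewrite -derive1E.
rewrite (@differentiation_under_integral R _ _ mu _ _ m0y _ _ _ vI intf derf _ G0 intG G_ub).
under eq_Rintegral do rewrite d1E -mulrN.
rewrite RintegralZr//; last exact: integrable0y_expRNM.
by rewrite /Rintegral integral0y_expRNM//= mulrC mulNr.
Qed.

End sine_tail.

(** * Truncated Hilbert kernels *)

Section truncated_kernels.
Context {R : realType}.
Notation mu := (@lebesgue_measure R).

Lemma Rintegral_FTC2 (f F : R -> R) (a b : R) : a <= b ->
  (forall s, a <= s <= b -> is_derive s 1 F (f s)) ->
  (forall s, a <= s <= b -> {for s, continuous f}) ->
  \int[mu]_(s in `[a, b]) f s = F b - F a.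
Proof.
rewrite le_eqVlt => /predU1P[<-|ab] dF cf.
  by rewrite set_itv1 Rintegral_set1 subrr.
have : {within `[a, b], continuous F}.
  apply: derivable_within_continuous => s; rewrite in_itv/= => sab.
  by have [] := dF _ sab.
move=> /(continuous_within_itvP _ ab)[_ Fa Fb].
rewrite /Rintegral (@continuous_FTC2 R f F a b) //.
- apply: continuous_in_subspaceT => s; rewrite inE/= in_itv/=; exact: cf.
- split=> // s; rewrite in_itv/= => /andP[as_ sb].
  by have [] : is_derive s 1 F (f s) by apply: dF; rewrite !ltW.
- move=> s; rewrite in_itv/= => /andP[as_ sb]; rewrite derive1E.
  by have [] : is_derive s 1 F (f s) by apply: dF; rewrite !ltW.
Qed.

Definition trunc_integral (g : R -> R) (x eps N : R) : R :=
  \int[mu]_(s in `[- N, x - eps]) g s + \int[mu]_(s in `[x + eps, N]) g s.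

Lemma eq_trunc_integral (g h : R -> R) (x eps N : R) :
  g =1 h -> trunc_integral g x eps N = trunc_integral h x eps N.
Proof. by move=> gh; congr (_ + _); apply: eq_Rintegral => s _; exact: gh. Qed.

(** * Parity of a kernel about its singularity *)

Section odd_even.
Variables (k P : R -> R) (x eps N : R).
Hypothesis dP : forall v, eps <= v -> is_derive v 1 P (k v).
Hypothesis ck : forall v, eps <= v -> {for v, continuous k}.
Hypotheses (epsl : eps <= x + N) (epsr : eps <= N - x).

Let intl : \int[mu]_(s in `[- N, x - eps]) k (x - s) = P (x + N) - P eps.
Proof.
have ab : - N <= x - eps by rewrite lerBrDr; move: epsl; lra.
have dF s : - N <= s <= x - eps ->
    is_derive s 1 (fun s => - P (x - s)) (k (x - s)).
  move=> /andP[_ sx]; have ve : eps <= x - s by lra.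
  have dPv := dP ve.
  have dc : is_derive s 1 (fun s => x - s) (- 1).
    by apply: is_derive_eq; rewrite add0r mul1r.
  have := @is_derive1_comp R P (fun s => x - s) s _ _ dPv dc.
  by move=> /is_deriveN; rewrite mulrN1 opprK.
have cf s : - N <= s <= x - eps -> {for s, continuous (fun s => k (x - s))}.
  move=> /andP[_ sx]; have ve : eps <= x - s by lra.
  apply: (@continuous_comp _ _ _ (fun s => x - s) k); last exact: ck.
  by apply: cvgB; [exact: cvg_cst|exact: cvg_id].
by rewrite (Rintegral_FTC2 ab dF cf) subKr !opprK addrC.
Qed.

Let intr : \int[mu]_(s in `[x + eps, N]) k (s - x) = P (N - x) - P eps.
Proof.
have ab : x + eps <= N by move: epsr; lra.
have dF s : x + eps <= s <= N -> is_derive s 1 (fun s => P (s - x)) (k (s - x)).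
  move=> /andP[sx _]; have ve : eps <= s - x by lra.
  have dPv := dP ve.
  have dc : is_derive s 1 (fun s => s - x) 1.
    by apply: is_derive_eq; rewrite subr0.
  by have := @is_derive1_comp R P (fun s => s - x) s _ _ dPv dc; rewrite mulr1.
have cf s : x + eps <= s <= N -> {for s, continuous (fun s => k (s - x))}.
  move=> /andP[sx _]; have ve : eps <= s - x by lra.
  apply: (@continuous_comp _ _ _ (fun s => s - x) k); last exact: ck.
  by apply: cvgB; [exact: cvg_id|exact: cvg_cst].
by rewrite (Rintegral_FTC2 ab dF cf) [x + eps]addrC addrK.
Qed.

(** The substitution v = x - s on the left and v = s - x on the right reduces both sides to a
    primitive on v >= [eps], where the kernel is regular. For even kernels the two contributions of
    the cut-off at [eps] add up. *)
Lemma trunc_integral_even : (forall v, k (- v) = k v) ->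
  trunc_integral (fun s => k (x - s)) x eps N =
  P (x + N) + P (N - x) - 2 * P eps.
Proof.
move=> ke; rewrite /trunc_integral intl.
under [X in _ + X]eq_Rintegral do rewrite -ke opprB.
by rewrite intr; ring.
Qed.

Lemma trunc_integral_odd : (forall v, k (- v) = - k v) ->
  trunc_integral (fun s => k (x - s)) x eps N = P (x + N) - P (N - x).
Proof.
move=> ko; rewrite /trunc_integral intl.
suff -> : \int[mu]_(s in `[x + eps, N]) k (x - s) = - (P (N - x) - P eps) by ring.
rewrite -intr -mulN1r -RintegralZl//.
  by apply: eq_Rintegral => s _; rewrite mulN1r -ko opprB.
apply: continuous_compact_integrable; first exact: segment_compact.
apply: continuous_in_subspaceT => s; rewrite inE/= in_itv/= => /andP[sx _].
have ve : eps <= s - x by lra.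
apply: (@continuous_comp _ _ _ (fun s => s - x) k); last exact: ck.
by apply: cvgB; [exact: cvg_id|exact: cvg_cst].
Qed.

End odd_even.

Definition sin_trunc (x tau eps N : R) : R :=
  trunc_integral (fun s => sin ((x - s) * tau) / (x - s)) x eps N.

Definition cos_trunc (x tau eps N : R) : R :=
  trunc_integral (fun s => cos ((x - s) * tau) / (x - s)) x eps N.

Lemma sin_truncE (x tau eps N : R) : 0 < eps -> eps <= x + N -> eps <= N - x ->
  sin_trunc x tau eps N = Num.sg tau *
    (2 * sine_tail (eps * `|tau|) - sine_tail ((x + N) * `|tau|)
                                  - sine_tail ((N - x) * `|tau|)).
Proof.
move=> e0 el er.
pose k v := sin (v * tau) / v.
(* The primitive of sin (v tau) / v is minus the sine tail at v |tau|, with the sign of tau in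
   front. The case tau = 0 is separate because the derivative of [sine_tail] is known only at
   positive points. *)
have dP v : eps <= v ->
    is_derive v 1 (fun v => - (Num.sg tau * sine_tail (v * `|tau|))) (k v).
  move=> ev; have v0 : 0 < v by exact: lt_le_trans ev.
  have [t0|tau0] := eqVneq tau 0.
    rewrite (_ : (fun _ => _) = cst 0); last first.
      by apply/funext => w; rewrite t0 sgr0 mul0r oppr0.
    by rewrite /k t0 mulr0 sin0 mul0r; exact: is_derive_cst.
  have vt : 0 < v * `|tau| by rewrite mulr_gt0// normr_gt0.
  have dT := is_derive_sine_tail vt.
  have dc : is_derive v 1 (fun v => v * `|tau|) `|tau|.
    by apply: is_derive_eq; rewrite scaler0 add0r /GRing.scale/= mulr1.
  have dcomp := @is_derive1_comp R sine_tail (fun v => v * `|tau|) v _ _ dT dc.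
  have -> : k v = - (Num.sg tau * (- (sin (v * `|tau|) / (v * `|tau|)) * `|tau|)).
    rewrite mulNr mulrN opprK.
    have -> : sin (v * `|tau|) / (v * `|tau|) * `|tau| = sin (v * `|tau|) / v.
      by field; rewrite normr_eq0 tau0 gt_eqF.
    move: tau0; rewrite neq_lt /k => /orP[tn|tp].
      by rewrite ltr0_sg// ltr0_norm// mulrN sinN; ring.
    by rewrite gtr0_sg// gtr0_norm// mul1r.
  exact: (is_deriveN (is_deriveZ (Num.sg tau) dcomp)).
have ck v : eps <= v -> {for v, continuous k}.
  move=> ev; have v0 : v != 0 by rewrite gt_eqF// (lt_le_trans e0).
  apply: cvgM; last exact: cvgV.
  apply: continuous_comp; last exact: continuous_sin.
  by apply: cvgM; [exact: cvg_id|exact: cvg_cst].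
have ke v : k (- v) = k v by rewrite /k mulNr sinN invrN mulrNN.
by rewrite /sin_trunc (trunc_integral_even dP ck el er ke); ring.
Qed.

(* [cos u / u] is odd, so the cut-offs at [eps] cancel and only the asymmetry of
   [-N, N] about [x] survives. *)
Lemma normr_cos_trunc_le (x tau eps N : R) :
  0 < eps -> eps <= x + N -> eps <= N - x ->
  `|cos_trunc x tau eps N| <= 2 * `|x| / (N - `|x|).
Proof.
move=> e0 el er.
have em : eps <= N - `|x|.
  by rewrite lerBrDr addrC -lerBrDr ler_norml; apply/andP; split; lra.
pose k v := cos (v * tau) / v.
have ck (c v : R) : 0 < c -> c <= v -> {for v, continuous k}.
  move=> c0 cv; have v0 : v != 0 by rewrite gt_eqF// (lt_le_trans c0).
  apply: cvgM; last exact: cvgV.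
  apply: continuous_comp; last exact: continuous_cos.
  by apply: cvgM; [exact: cvg_id|exact: cvg_cst].
have e20 : 0 < eps / 2 by rewrite divr_gt0.
(* Only differences of the primitive matter, so any base point would do; eps / 2 makes v = eps an
   interior point, where the fundamental theorem gives a two-sided derivative. *)
pose E v := \int[mu]_(u in `[eps / 2, v]) k u.
have dE v : eps <= v -> is_derive v 1 E (k v).
  move=> ev; have v1 : v < v + 1 by rewrite ltrDl.
  have ik : mu.-integrable `[eps / 2, v + 1] (EFin \o k).
    apply: continuous_compact_integrable; first exact: segment_compact.
    apply: continuous_in_subspaceT => s; rewrite inE/= in_itv/= => /andP[es _].
    exact: ck es.
  have ev2 : eps / 2 < v by lra.
  have cv : {for v, continuous k} by apply: ck e0 ev.
  have [? Ek] := continuous_FTC1_closed v1 ik ev2 cv.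
  by apply: DeriveDef => //; rewrite -derive1E.
have cE v : eps <= v -> {for v, continuous k} by exact: ck.
have ko v : k (- v) = - k v by rewrite /k mulNr cosN invrN mulrN.
rewrite /cos_trunc (trunc_integral_odd dE cE el er ko).
(* What remains is E (x + N) - E (N - x). Both arguments are at least N - |x|, where |k| <= 1 / (N -
   |x|), and they differ by 2 |x|; the frequency disappears because |cos| <= 1. *)
have lipE (a b : R) : N - `|x| <= a -> a <= b ->
    `|E b - E a| <= (b - a) / (N - `|x|).
  move=> ma ab.
  have [| |c] := @MVT_segment R E k a b ab.
  - by move=> c; rewrite in_itv/= => /andP[ac _]; apply: dE; lra.
  - apply: derivable_within_continuous => c; rewrite in_itv/= => /andP[ac _].
    by have [] : is_derive c 1 E (k c) by apply: dE; lra.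
  - rewrite in_itv/= => /andP[ac cb] ->; rewrite normrM mulrC.
    rewrite (@ger0_norm _ (b - a)) ?subr_ge0// ler_wpM2l ?subr_ge0//.
    rewrite /k normrM -[leRHS]mul1r ler_pM// ?cos_max// normfV lef_pV2 ?posrE; last 2 first.
    - by rewrite normr_gt0 gt_eqF//; lra.
    - by lra.
    by rewrite ler_normr; apply/orP; left; lra.
have [x0|x0] := lerP 0 x.
  apply: (le_trans (lipE _ _ _ _)); rewrite ?(ger0_norm x0); [lra|lra|].
  rewrite ler_wpM2r//; last by lra.
  by rewrite invr_ge0; move: em; rewrite ger0_norm//; lra.
rewrite distrC; apply: (le_trans (lipE _ _ _ _)); rewrite ?(ltr0_norm x0); [lra|lra|].
rewrite ler_wpM2r//; last by lra.
by rewrite invr_ge0; move: em; rewrite ltr0_norm//; lra.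
Qed.

Local Notation trunc_filter := (filter_prod (0 : R)^'+ (pinfty_nbhs R)).

Lemma near_trunc (x M : R) : \forall p \near trunc_filter,
  [/\ 0 < p.1, p.1 <= x + p.2, p.1 <= p.2 - x & M <= p.2 - `|x|].
Proof.
(* With eps < 1 and N > |x| + |M| + 1, the extra 1 leaves room for eps on both sides of x. *)
have e1 : (0 : R)^'+ [set e | 0 < e < 1].
  by near=> e; apply/andP; split; [|near: e; apply: nbhs_right_lt].
have N1 : pinfty_nbhs R [set N | `|x| + `|M| + 1 < N] by exact: nbhs_pinfty_gt.
exists ([set e | 0 < e < 1], [set N | `|x| + `|M| + 1 < N]); first by split.
move=> [e N] /= [/andP[e0 eN1] xN]; have := ler_norm x; have := ler_norm (- x).
rewrite normrN; have := ler_norm M; have := normr_ge0 M.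
by split => //; lra.
Unshelve. all: by end_near. Qed.

Lemma cvg_sin_trunc (x tau : R) :
  sin_trunc x tau p.1 p.2 @[p --> trunc_filter] --> pi * Num.sg tau.
Proof.
have [t0|tau0] := eqVneq tau 0.
  rewrite t0 sgr0 mulr0.
  suff : cst (0 : R) p @[p --> trunc_filter] --> (0 : R).
    apply: cvg_trans; apply: near_eq_cvg.
    apply: filterS (near_trunc x 0) => -[e N] [/= e0 el er _].
    by rewrite sin_truncE// sgr0 mul0r.
  exact: cvg_cst.
have tau_gt0 : 0 < `|tau| by rewrite normr_gt0.
have ct : e * `|tau| @[e --> (0 : R)^'+] --> (0 : R)^'+.
  move=> A [d /= d0 dA].
  suff : \forall e \near (0 : R)^'+, A (e * `|tau|) by [].
  near=> e; apply: dA => /=; last first.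
    by rewrite mulr_gt0//; near: e; exact: nbhs_right_gt.
  rewrite sub0r normrN normrM (gtr0_norm tau_gt0) -ltr_pdivlMr// gtr0_norm//.
  by near: e; apply: nbhs_right_lt; rewrite divr_gt0.
have cT0 : sine_tail (p.1 * `|tau|) @[p --> trunc_filter] --> pi / 2.
  apply: (cvg_comp (fun p : R * R => p.1) (fun e => sine_tail (e * `|tau|))).
    exact: cvg_fst.
  exact: (cvg_comp (fun e => e * `|tau|) sine_tail ct cvg0_sine_tail).
have cTy (c : R) (h : R -> R) : (forall N, h N = N + c) ->
    sine_tail (h p.2 * `|tau|) @[p --> trunc_filter] --> 0.
  move=> hE.
  apply: (cvg_comp (fun p : R * R => p.2) (fun N => sine_tail (h N * `|tau|))).
    exact: cvg_snd.
  apply: (cvg_comp (fun N => h N * `|tau|) sine_tail _ cvgy_sine_tail).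
  apply: gt0_cvgMly => //; apply/cvgryPge => B; near=> N.
  by rewrite hE -lerBlDr; near: N; exact: nbhs_pinfty_ge.
have -> : pi * Num.sg tau = Num.sg tau * (2 * (pi / 2) - 0 - 0) by field.
have main : Num.sg tau * (2 * sine_tail (p.1 * `|tau|)
    - sine_tail ((x + p.2) * `|tau|) - sine_tail ((p.2 - x) * `|tau|))
    @[p --> trunc_filter] --> Num.sg tau * (2 * (pi / 2) - 0 - 0).
  have c1 := cTy x (fun N => x + N) (fun N => addrC x N).
  have c2 := cTy (- x) (fun N => N - x) (fun N => erefl).
  by apply: cvgMr; apply: cvgB c2; apply: cvgB c1; exact: cvgMr.
apply: cvg_trans main; apply: near_eq_cvg.
apply: filterS (near_trunc x 0) => -[e N] [/= e0 el er _].
by rewrite sin_truncE.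
Unshelve. all: by end_near. Qed.

(** Each of the three sine tails is at most pi in modulus, and the one at [eps] counts twice, which
    gives 4 pi. The neighbourhood does not depend on [tau], as domination in t requires. *)
Lemma near_sin_trunc_le (x : R) : \forall p \near trunc_filter,
  forall tau, `|sin_trunc x tau p.1 p.2| <= 4 * pi.
Proof.
apply: filterS (near_trunc x 0) => -[e N] [/= e0 el er _] tau.
rewrite sin_truncE// normrM.
have t0 := normr_ge0 tau.
have T1 : `|sine_tail (e * `|tau|)| <= pi.
  by apply: normr_sine_tail_le; rewrite mulr_ge0// ltW.
have T2 : `|sine_tail ((x + N) * `|tau|)| <= pi.
  by apply: normr_sine_tail_le; rewrite mulr_ge0// (le_trans (ltW e0)).
have T3 : `|sine_tail ((N - x) * `|tau|)| <= pi.
  by apply: normr_sine_tail_le; rewrite mulr_ge0// (le_trans (ltW e0)).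
have sg1 : `|Num.sg tau| <= 1 by rewrite normr_sg; case: (tau != 0).
rewrite -[leRHS]mul1r ler_pM//.
move: T1 T2 T3; rewrite !ler_norml => /andP[? ?] /andP[? ?] /andP[? ?].
by apply/andP; split; lra.
Qed.

Lemma near_cos_trunc_le (x e : R) : 0 < e -> \forall p \near trunc_filter,
  forall tau, `|cos_trunc x tau p.1 p.2| <= e.
Proof.
move=> e0; apply: filterS (near_trunc x (2 * `|x| / e)) => -[d N] [/= d0 dl dr M] tau.
rewrite (le_trans (normr_cos_trunc_le tau d0 dl dr))//.
have xN : 0 < N - `|x|.
  by rewrite (lt_le_trans d0)// lerBrDr addrC -lerBrDr ler_norml; apply/andP; split; lra.
by rewrite ler_pdivrMr// [e * _]mulrC -ler_pdivrMr.
Qed.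

Lemma cvg_cos_trunc (x tau : R) :
  cos_trunc x tau p.1 p.2 @[p --> trunc_filter] --> 0.
Proof.
apply/cvgrPdist_le => e e0; apply: filterS (near_cos_trunc_le x e0) => p.
by move=> /(_ tau); rewrite sub0r normrN.
Qed.

End truncated_kernels.

(** * Exchange of integrals against a truncated kernel *)

Section fubini_kernel.
Context {R : realType}.
Notation mu := (@lebesgue_measure R).
Variables (I : set R) (w : R -> R) (M : R) (g : R -> R -> R) (G : R -> R).
Hypotheses (mI : measurable I) (muI : (mu I < +oo)%E).
Hypotheses (mw : measurable_fun I w) (wM : forall s, I s -> `|w s| <= M).
Hypothesis mg : measurable_fun [set: R * R] (fun z => g z.1 z.2).
Hypothesis gG : forall s t, `|g s t| <= G t.
Hypothesis iG : mu.-integrable setT (EFin \o G).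

(** Extending the weight by zero moves the problem to the full product R x R, where Fubini
    applies. *)
Let W := w \_ I.

(** Nothing makes [M] nonnegative when [I] is empty; its absolute value keeps the majorant
    nonnegative. *)
Let W_le s : `|W s| <= `|M| * \1_I s.
Proof.
rewrite /W patchE; have [sI|sI] := boolP (s \in I).
  by rewrite indicE sI mulr1 (le_trans (wM _)) ?ler_norm//; exact: set_mem.
by rewrite normr0 mulr_ge0.
Qed.

Let mW : measurable_fun [set: R] W.
Proof. exact/(measurable_restrictT _ mI). Qed.

Let G0 t : 0 <= G t. Proof. exact: le_trans (gG 0 t). Qed.

Let mG : measurable_fun [set: R] G.
Proof. by apply/measurable_EFinP; exact: measurable_int iG. Qed.

Let mgs s : measurable_fun [set: R] (g s).
Proof. exact: (measurableT_comp mg (pair1_measurable s)). Qed.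

Let mgt t : measurable_fun [set: R] (g ^~ t).
Proof. exact: (measurableT_comp mg (pair2_measurable t)). Qed.

Let h (z : R * R) := (g z.1 z.2 * W z.1)%:E.

Let mh : measurable_fun [set: R * R] h.
Proof.
apply/measurable_EFinP; apply: measurable_funM mg _.
exact: (measurableT_comp mW measurable_fst).
Qed.

Let igs s : mu.-integrable setT (EFin \o g s).
Proof.
apply: le_integrable iG => //; first by apply/measurable_EFinP; exact: mgs.
by move=> t _ /=; rewrite lee_fin (le_trans (gG s t))// ler_norm.
Qed.

Let igt t : mu.-integrable I (fun s => (g s t * w s)%:E).
Proof.
apply: measurable_bounded_integrable => //.
  by apply: measurable_funM => //; apply: measurable_funTS; exact: mgt.
exists (G t * `|M|); split; first exact: num_real.
move=> y Gy s Is /=; rewrite normrM (le_trans _ (ltW Gy))// ler_pM//.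
by rewrite (le_trans (wM Is))// ler_norm.
Qed.

(** By Tonelli: the modulus is at most |M| 1_I(s) G(t), a product of integrable functions of one
    variable, since [I] has finite measure. *)
Let ih : (mu \x mu)%E.-integrable setT h.
Proof.
apply: (iffRL (@integrable12ltyP _ _ _ _ R mu mu h mh)).
have GK : (\int[mu]_t (G t)%:E)%E = (\int[mu]_t G t)%:E.
  by rewrite fineK//; exact: integrable_fin_num.
have K0 : 0 <= \int[mu]_t G t by exact: Rintegral_ge0.
apply: (@le_lt_trans _ _
  (\int[mu]_s ((\int[mu]_t G t * `|M|)%:E * (\1_I s)%:E))%E).
  apply: ge0_le_integral => //.
  - by move=> s _; exact: integral_ge0.
  - have mah : measurable_fun [set: R * R] (abse \o h) by exact: measurableT_comp.
    exact: (@measurable_fun_fubini_tonelli_F _ _ _ _ R mu _ mah (fun z => abse_ge0 _)).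
  - by apply/measurable_EFinP/measurable_funM => //; exact: measurable_indic.
  move=> s _.
  apply: (@le_trans _ _ (\int[mu]_t ((`|M| * \1_I s)%:E * (G t)%:E))%E).
    apply: ge0_le_integral => //.
    - apply/measurable_EFinP; apply: measurableT_comp => //.
      by apply: measurable_funM; [exact: mgs|rewrite /=; exact: measurable_cst].
    - by apply/measurable_EFinP; exact: measurable_funM.
    - move=> t _; rewrite lee_fin normrM mulrC ler_pM//.
  rewrite ge0_integralZl//; last 2 first.
  - exact/measurable_EFinP.
  - by move=> t _; rewrite lee_fin.
  by rewrite GK -!EFinM lee_fin mulrC mulrA.
rewrite ge0_integralZl//; last 2 first.
- by apply/measurable_EFinP; exact: measurable_indic.
- by rewrite lee_fin mulr_ge0.
rewrite integral_indic// setIT.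
by rewrite lte_mul_pinfty// lee_fin mulr_ge0.
Qed.

Let hF s : fubini_F mu h s = ((\int[mu]_t g s t) * W s)%:E.
Proof.
rewrite /fubini_F /h/=; under eq_integral do rewrite EFinM.
rewrite integralZr//; last exact: igs.
by rewrite -[X in (X * _)%E]fineK//; apply: integrable_fin_num => //; exact: igs.
Qed.

Let hG t : fubini_G mu h t = (\int[mu]_(s in I) (g s t * w s))%:E.
Proof.
rewrite /fubini_G /h/= fineK; last by apply: integrable_fin_num => //; exact: igt.
rewrite [RHS]integral_mkcond; apply: eq_integral => s _.
by rewrite /W !patchE; case: ifP => //; rewrite mulr0.
Qed.

Let FW : (fun s => ((\int[mu]_t g s t) * W s)%:E) =
         (fun s => ((\int[mu]_t g s t) * w s)%:E) \_ I.
Proof.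
by apply/funext => s; rewrite /W !patchE; case: ifP => //; rewrite mulr0.
Qed.

Lemma integrable_kernelF :
  mu.-integrable I (fun s => ((\int[mu]_t g s t) * w s)%:E).
Proof.
rewrite integrable_mkcond// -FW.
by move: (integrable_fubini_F ih); apply: eq_integrable => // s _; exact: hF.
Qed.

Lemma measurable_kernelG :
  measurable_fun [set: R] (fun t => \int[mu]_(s in I) (g s t * w s)).
Proof.
apply/measurable_EFinP.
by rewrite (_ : _ \o _ = fubini_G mu h);
  [exact: (measurable_fubini_G ih)|apply/funext => t; rewrite hG].
Qed.

Lemma Fubini_kernel :
  \int[mu]_(s in I) ((\int[mu]_t g s t) * w s) =
  \int[mu]_t \int[mu]_(s in I) (g s t * w s).
Proof.
rewrite /Rintegral; congr fine.
rewrite [LHS]integral_mkcond -FW.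
under eq_integral do rewrite -hF.
rewrite [RHS](_ : _ = \int[mu]_t fubini_G mu h t)%E; last first.
  by apply: eq_integral => t _; rewrite hG.
exact: Fubini ih.
Qed.

End fubini_kernel.

(** * Hilbert transform of real Fourier integrals *)

Section hilbert_wave.
Context {R : realType}.
Notation mu := (@lebesgue_measure R).
Local Notation trunc_filter := (filter_prod (0 : R)^'+ (pinfty_nbhs R)).

(* The real part of [(p t + i q t) exp(- i s (tau t))]. A general phase [tau],
   rather than [tau t = t], also covers the translates of [f] needed for the
   injectivity of the Fourier transform. *)
Definition wave (tau p q : R -> R) (s t : R) : R :=
  p t * cos (s * tau t) + q t * sin (s * tau t).

Definition wave_integral (tau p q : R -> R) (s : R) : R :=
  \int[mu]_t wave tau p q s t.

(** * Integration over the truncated line, where the kernel is bounded by 1 / eps *)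

Section trunc_set.
Variables (x eps N : R).
Hypothesis eps0 : 0 < eps.

Let U : set R := `[- N, x - eps] `|` `[x + eps, N].

Let mU : measurable U. Proof. exact: measurableU. Qed.

Let U_far s : U s -> eps <= `|x - s|.
Proof.
by case=> /=; rewrite in_itv/= => /andP[? ?]; rewrite ler_normr; apply/orP;
  [left|right]; lra.
Qed.

Let muU : (mu U < +oo)%E.
Proof.
apply: le_lt_trans (measureU2 _ _ _) _ => //.
have fin (a b : R) : (mu `[a, b] < +oo)%E.
  by rewrite lebesgue_measure_itv/=; case: ifPn => _; rewrite ?ltry// -EFinD ltry.
by apply: lte_add_pinfty; exact: fin.
Qed.

Let w s := (x - s)^-1.

Let mw : measurable_fun U w.
Proof.
have oD : open (~` [set x]) by exact/closed_openC/closed_eq.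
apply: (@measurable_funS _ _ _ _ (~` [set x])); first exact: open_measurable.
  by move=> s /U_far sx sE; move: sx; rewrite sE subrr normr0 leNgt eps0.
apply: open_continuous_measurable_fun => // s; rewrite inE/= => sx.
apply: cvgV; first by rewrite subr_eq0; apply/eqP => xs; exact: sx.
by apply: cvgB; [exact: cvg_cst|exact: cvg_id].
Qed.

Let w_le s : U s -> `|w s| <= eps^-1.
Proof.
move=> /U_far es; rewrite normfV lef_pV2 ?posrE//.
exact: lt_le_trans es.
Qed.

Let integrable_w (k : R -> R) : measurable_fun setT k ->
  (forall s, `|k s| <= 1) -> mu.-integrable U (fun s => (k s / (x - s))%:E).
Proof.
move=> mk k1; apply: measurable_bounded_integrable => //.
  by apply: measurable_funM => //; exact: measurable_funTS.
exists eps^-1; split; first exact: num_real.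
move=> y ey s Us /=; rewrite normrM (le_trans _ (ltW ey))// -[leRHS]mul1r.
by rewrite ler_pM// w_le.
Qed.

Lemma trunc_integralE (g : R -> R) : mu.-integrable U (EFin \o g) ->
  trunc_integral g x eps N = \int[mu]_(s in U) g s.
Proof.
move=> ig; rewrite Rintegral_setU//; apply/disj_setPLR => s /=.
rewrite !in_itv/= => /andP[_ sx]; apply/negP; rewrite negb_and -!ltNge.
apply/orP; left; apply: le_lt_trans sx _.
by rewrite ltrD2l gtrN.
Qed.

Variables (tau p q : R -> R).
Hypotheses (mtau : measurable_fun setT tau).
Hypotheses (ip : mu.-integrable setT (EFin \o p)).
Hypotheses (iq : mu.-integrable setT (EFin \o q)).

Let mp : measurable_fun [set: R] p.
Proof. by apply/measurable_EFinP; exact: measurable_int ip. Qed.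

Let mq : measurable_fun [set: R] q.
Proof. by apply/measurable_EFinP; exact: measurable_int iq. Qed.

Let mwave : measurable_fun [set: R * R] (fun z => wave tau p q z.1 z.2).
Proof.
have mt : measurable_fun [set: R * R] (fun z : R * R => z.1 * tau z.2).
  apply: measurable_funM; first exact: measurable_fst.
  exact: (measurableT_comp mtau measurable_snd).
apply: measurable_funD; apply: measurable_funM.
- exact: (measurableT_comp mp measurable_snd).
- exact: (measurableT_comp (continuous_measurable_fun (@continuous_cos R)) mt).
- exact: (measurableT_comp mq measurable_snd).
- exact: (measurableT_comp (continuous_measurable_fun (@continuous_sin R)) mt).
Qed.

Let wave_le s t : `|wave tau p q s t| <= `|p t| + `|q t|.
Proof.
rewrite (le_trans (ler_normD _ _))// lerD// normrM ler_piMr//.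
  exact: cos_max.
exact: sin_max.
Qed.

Let iG : mu.-integrable setT (EFin \o (fun t => `|p t| + `|q t|)).
Proof.
exact: (integrableD _ (integrable_norm ip) (integrable_norm iq)).
Qed.

Let ikernel : mu.-integrable U (fun s => (wave_integral tau p q s / (x - s))%:E).
Proof. exact: (integrable_kernelF mU muU mw w_le mwave wave_le iG). Qed.

Lemma integrable_wave_kernel :
  mu.-integrable `[- N, x - eps] (fun s => (wave_integral tau p q s / (x - s))%:E) /\
  mu.-integrable `[x + eps, N] (fun s => (wave_integral tau p q s / (x - s))%:E).
Proof.
by split; apply: integrableS ikernel => // s; [left|right].
Qed.

(** Writing s tau as x tau - (x - s) tau separates the phase at x from the kernel. The cosine factor
    multiplies the wave itself and tends to 0; the sine factor multiplies the conjugate wave and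
    tends to pi sgn tau. *)
Lemma wave_kernelE t : \int[mu]_(s in U) (wave tau p q s t / (x - s)) =
  (p t * cos (x * tau t) + q t * sin (x * tau t)) * cos_trunc x (tau t) eps N +
  (p t * sin (x * tau t) - q t * cos (x * tau t)) * sin_trunc x (tau t) eps N.
Proof.
have mx : measurable_fun [set: R] (fun s => (x - s) * tau t).
  by apply: measurable_funM => //; exact: measurable_funB.
have ic : mu.-integrable U (fun s => (cos ((x - s) * tau t) / (x - s))%:E).
  apply: integrable_w; last by move=> s; exact: cos_max.
  exact: (measurableT_comp (continuous_measurable_fun (@continuous_cos R)) mx).
have is_ : mu.-integrable U (fun s => (sin ((x - s) * tau t) / (x - s))%:E).
  apply: integrable_w; last by move=> s; exact: sin_max.
  exact: (measurableT_comp (continuous_measurable_fun (@continuous_sin R)) mx).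
rewrite /cos_trunc /sin_trunc (trunc_integralE ic) (trunc_integralE is_).
rewrite -!RintegralZl//.
rewrite -RintegralD//; last 2 first.
- exact: (integrableZl _ (p t * cos (x * tau t) + q t * sin (x * tau t)) ic).
- exact: (integrableZl _ (p t * sin (x * tau t) - q t * cos (x * tau t)) is_).
apply: eq_Rintegral => s _; rewrite /wave.
have -> : s * tau t = x * tau t - (x - s) * tau t by ring.
by rewrite cosB sinB; ring.
Qed.

Lemma trunc_wave_integralE :
  measurable_fun [set: R] (fun t => \int[mu]_(s in U) (wave tau p q s t / (x - s))) /\
  trunc_integral (fun s => wave_integral tau p q s / (x - s)) x eps N =
  \int[mu]_t \int[mu]_(s in U) (wave tau p q s t / (x - s)).
Proof.
split; first exact: (measurable_kernelG mU muU mw w_le mwave wave_le iG).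
rewrite (trunc_integralE ikernel).
exact: (Fubini_kernel mU muU mw w_le mwave wave_le iG).
Qed.

End trunc_set.

Section principal_value.
Variables (tau p q : R -> R).
Hypotheses (mtau : measurable_fun setT tau).
Hypotheses (ip : mu.-integrable setT (EFin \o p)).
Hypotheses (iq : mu.-integrable setT (EFin \o q)).

Lemma measurable_sgr : measurable_fun [set: R] (Num.sg : R -> R).
Proof.
apply: nondecreasing_measurable => // a b ab.
have [a0|a0|a0] := ltrgt0P a.
- by rewrite (gtr0_sg a0) gtr0_sg// (lt_le_trans a0).
- by rewrite (ltr0_sg a0); case: (sgrP b); lra.
- by rewrite a0 sgr0 sgr_ge0 -a0.
Qed.

Lemma integrable_sgrM (r : R -> R) : mu.-integrable setT (EFin \o r) ->
  mu.-integrable setT (EFin \o (fun t => Num.sg (tau t) * r t)).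
Proof.
move=> ir; apply: (le_integrable _ _ _ ir) => //.
  apply/measurable_EFinP; apply: measurable_funM.
    exact: (measurableT_comp measurable_sgr mtau).
  by apply/measurable_EFinP; exact: measurable_int ir.
move=> t _ /=; rewrite lee_fin normrM ler_piMl// normr_sg.
by case: (tau t != 0).
Qed.

Lemma integrable_wave s : mu.-integrable setT (EFin \o wave tau p q s).
Proof.
have mt : measurable_fun [set: R] (fun t => s * tau t).
  by apply: measurable_funM.
have ipc : mu.-integrable setT (EFin \o (fun t => p t * cos (s * tau t))).
  apply: (le_integrable _ _ _ ip) => //.
    apply/measurable_EFinP; apply: measurable_funM.
      by apply/measurable_EFinP; exact: measurable_int ip.
    exact: (measurableT_comp (continuous_measurable_fun (@continuous_cos R)) mt).
  by move=> t _ /=; rewrite lee_fin normrM ler_piMr// cos_max.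
have iqs : mu.-integrable setT (EFin \o (fun t => q t * sin (s * tau t))).
  apply: (le_integrable _ _ _ iq) => //.
    apply/measurable_EFinP; apply: measurable_funM.
      by apply/measurable_EFinP; exact: measurable_int iq.
    exact: (measurableT_comp (continuous_measurable_fun (@continuous_sin R)) mt).
  by move=> t _ /=; rewrite lee_fin normrM ler_piMr// sin_max.
exact: (integrableD _ ipc iqs).
Qed.

End principal_value.

(** Passing from (p, q) to (- sg q, sg p) is multiplication of p + i q by i sgn tau, so this is the
    real part of the multiplier formula, before division by pi. *)
Lemma cvg_trunc_wave_integral (tau p q : R -> R) (x : R) :
  measurable_fun setT tau ->
  mu.-integrable setT (EFin \o p) -> mu.-integrable setT (EFin \o q) ->
  trunc_integral (fun s => wave_integral tau p q s / (x - s)) x a.1 a.2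
    @[a --> trunc_filter] -->
  pi * wave_integral tau (fun t => - (Num.sg (tau t) * q t))
                         (fun t => Num.sg (tau t) * p t) x.
Proof.
move=> mtau ip iq.
have isp := integrable_sgrM mtau ip.
have isq : mu.-integrable setT (EFin \o (fun t => - (Num.sg (tau t) * q t))).
  exact: (integrableN (integrable_sgrM mtau iq)).
have iw := integrable_wave mtau isq isp x.
rewrite /wave_integral -RintegralZl//.
pose f (a : R * R) t := \int[mu]_(s in `[- a.2, x - a.1] `|` `[x + a.1, a.2])
  (wave tau p q s t / (x - s)).
(* The 1 bounds the cosine factor, which is eventually as small as desired; 4 pi bounds the sine
   factor. *)
pose g t := (`|p t| + `|q t|) * (1 + 4 * pi).
have ig : mu.-integrable setT (EFin \o g).
  have igr : mu.-integrable setT (EFin \o (fun t => `|p t| + `|q t|)).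
    exact: (integrableD _ (integrable_norm ip) (integrable_norm iq)).
  exact: (integrableZr _ (1 + 4 * pi) igr).
have fE : \forall a \near trunc_filter, 0 < a.1.
  by apply: filterS (near_trunc x 0) => a [].
have main : \int[mu]_t f a t @[a --> trunc_filter] -->
  \int[mu]_t (pi * wave tau (fun t => - (Num.sg (tau t) * q t))
                         (fun t => Num.sg (tau t) * p t) x t).
  apply: (@dominated_cvg_nested_basis R _ _ mu setT _ trunc_filter f _ g) => //.
  - apply: filter_prod_nested_basis; first exact: at_right_nested_basis.
    exact: pinfty_nested_basis.
  - apply: filterS fE => a a0.
    by have [] := trunc_wave_integralE x a.2 a0 mtau ip iq.
  - apply: measurable_funM => //.
    by apply/measurable_EFinP; exact: measurable_int iw.
  - apply: aeW => t _.
    have c1 : (p t * cos (x * tau t) + q t * sin (x * tau t)) *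
        cos_trunc x (tau t) a.1 a.2 +
      (p t * sin (x * tau t) - q t * cos (x * tau t)) *
        sin_trunc x (tau t) a.1 a.2 @[a --> trunc_filter] -->
      (p t * cos (x * tau t) + q t * sin (x * tau t)) * 0 +
      (p t * sin (x * tau t) - q t * cos (x * tau t)) * (pi * Num.sg (tau t)).
      by apply: cvgD; apply: cvgMr; [exact: cvg_cos_trunc|exact: cvg_sin_trunc].
    rewrite [X in _ --> X](_ : _ =
      (p t * cos (x * tau t) + q t * sin (x * tau t)) * 0 +
      (p t * sin (x * tau t) - q t * cos (x * tau t)) * (pi * Num.sg (tau t)));
      last by rewrite /wave; ring.
    apply: cvg_trans c1; apply: near_eq_cvg; apply: filterS fE => a a0.
    by rewrite /f wave_kernelE.
  - apply: filterS3 fE (near_cos_trunc_le x ltr01) (near_sin_trunc_le x) =>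
      a a0 ca sa t _.
    have -> : g t = (`|p t| + `|q t|) * 1 + (`|p t| + `|q t|) * (4 * pi).
      by rewrite /g mulrDr.
    rewrite /f wave_kernelE// (le_trans (ler_normD _ _))// lerD// normrM.
      rewrite ler_pM// (le_trans (ler_normD _ _))// lerD// normrM.
        by rewrite ler_piMr// cos_max.
      by rewrite ler_piMr// sin_max.
    rewrite ler_pM// (le_trans (ler_normB _ _))// lerD// normrM.
      by rewrite ler_piMr// sin_max.
    by rewrite ler_piMr// cos_max.
apply: cvg_trans main; apply: near_eq_cvg; apply: filterS fE => a a0.
by have [_ ->] := trunc_wave_integralE x a.2 a0 mtau ip iq.
Qed.

End hilbert_wave.

(** * Injectivity of the Fourier transform *)

Section injectivity.
Context {R : realType}.
Notation mu := (@lebesgue_measure R).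
Local Notation trunc_filter := (filter_prod (0 : R)^'+ (pinfty_nbhs R)).

Lemma integrable_lin (a b : R) (p q : R -> R) :
  mu.-integrable setT (EFin \o p) -> mu.-integrable setT (EFin \o q) ->
  mu.-integrable setT (EFin \o (fun t => a * p t + b * q t)).
Proof.
by move=> ip iq; exact: (integrableD _ (integrableZl _ a ip) (integrableZl _ b iq)).
Qed.

Lemma wave_integral_lin (tau : R -> R) (a b : R) (p q p' q' : R -> R) (x : R) :
  measurable_fun setT tau ->
  mu.-integrable setT (EFin \o p) -> mu.-integrable setT (EFin \o q) ->
  mu.-integrable setT (EFin \o p') -> mu.-integrable setT (EFin \o q') ->
  wave_integral tau (fun t => a * p t + b * p' t)
                    (fun t => a * q t + b * q' t) x =
  a * wave_integral tau p q x + b * wave_integral tau p' q' x.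
Proof.
move=> mtau ip iq ip' iq'.
have iw := integrable_wave mtau ip iq x.
have iw' := integrable_wave mtau ip' iq' x.
rewrite /wave_integral -!RintegralZl// -RintegralD//; last 2 first.
- exact: (integrableZl _ a iw).
- exact: (integrableZl _ b iw').
by apply: eq_Rintegral => t _; rewrite /wave; ring.
Qed.

Lemma integral_itvNy_eq0_ae (p : R -> R) : mu.-integrable setT (EFin \o p) ->
  (forall a, \int[mu]_(t in `]-oo, a]) p t = 0) -> {ae mu, forall t, p t = 0}.
Proof.
move=> ip p0.
have ipa a : mu.-integrable `]-oo, a] (EFin \o p) by exact: integrableS ip.
have locp : locally_integrable [set: R] p.
  by apply: open_integrable_locally => //; exact: openT.
have := FTC1Ny ipa locp.
apply: filterS; first exact: (ae_filter_ringOfSetsType mu).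
move=> t [_ <-].
rewrite (_ : (fun _ => _) = cst 0); last by apply/funext => a; exact: p0.
by rewrite derive1_cst.
Qed.

(** The integrals of [p] to the left and to the right of a have sum 0 and difference 0, so both
    vanish; the point a itself is null. *)
Lemma integral_sgr_eq0_ae (p : R -> R) : mu.-integrable setT (EFin \o p) ->
  \int[mu]_t p t = 0 -> (forall a, \int[mu]_t (Num.sg (t - a) * p t) = 0) ->
  {ae mu, forall t, p t = 0}.
Proof.
move=> ip p0 sp0; apply: integral_itvNy_eq0_ae => // a.
have mta : measurable_fun setT (fun t : R => t - a) by exact: measurable_funB.
have isp := integrable_sgrM mta ip.
have split_ (g : R -> R) : mu.-integrable setT (EFin \o g) ->
    \int[mu]_t g t = \int[mu]_(t in `]-oo, a[) g t + \int[mu]_(t in `]a, +oo[) g t.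
  move=> ig.
  have igl : mu.-integrable `]-oo, a[ (EFin \o g) by exact: integrableS ig.
  have igr : mu.-integrable `]a, +oo[ (EFin \o g) by exact: integrableS ig.
  rewrite (Rintegral_itv_obnd_cbnd igr) -Rintegral_setU//.
  - congr Rintegral; apply/seteqP; split => // t _ /=.
    by rewrite !in_itv/= andbT; case: (ltP t a) => _; [left|right].
  - by apply: (integrableS _ _ _ ig) => //; exact: measurableU.
  - by apply/disj_setPLR => t /=; rewrite !in_itv/= andbT => ta; apply/negP; rewrite -ltNge.
have ipl : mu.-integrable `]-oo, a[ (EFin \o p) by exact: integrableS ip.
rewrite -(Rintegral_itv_bndo_bndc ipl).
have := sp0 a; rewrite (split_ _ isp).
rewrite (_ : \int[mu]_(t in `]-oo, a[) (Num.sg (t - a) * p t) =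
             - \int[mu]_(t in `]-oo, a[) p t); last first.
  rewrite -[RHS]mulN1r -RintegralZl//; apply: eq_Rintegral => t.
  by rewrite inE/= in_itv/= => ta; rewrite ltr0_sg ?subr_lt0// mulN1r.
rewrite (_ : \int[mu]_(t in `]a, +oo[) (Num.sg (t - a) * p t) =
             \int[mu]_(t in `]a, +oo[) p t); last first.
  apply: eq_Rintegral => t.
  by rewrite inE/= in_itv/= andbT => ta; rewrite gtr0_sg ?subr_gt0// mul1r.
by move: p0; rewrite (split_ _ ip); lra.
Qed.

(* A vanishing Fourier transform has a vanishing Hilbert transform, also after
   translating [f] by [a]; at the origin the latter is, up to a constant, the
   integral of [f] against the sign of [t - a]. *)
Lemma wave_integral_eq0_ae (p q : R -> R) :
  mu.-integrable setT (EFin \o p) -> mu.-integrable setT (EFin \o q) ->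
  (forall x, wave_integral id p q x = 0) ->
  (forall x, wave_integral id q (fun t => - p t) x = 0) ->
  {ae mu, forall t, q t = 0}.
Proof.
move=> ip iq W1 W2.
have mid : measurable_fun setT (@id R) by exact: measurable_id.
have iNp : mu.-integrable setT (EFin \o (fun t => - p t)) by exact: (integrableN ip).
apply: integral_sgr_eq0_ae => // [|a].
  rewrite -[RHS](W2 0); apply: eq_Rintegral => t _.
  by rewrite /wave mul0r cos0 sin0; ring.
have mta : measurable_fun setT (fun t : R => t - a) by exact: measurable_funB.
(* Translation multiplies the transform by exp(i s a), which mixes its real and imaginary parts;
   this is why both are assumed to vanish. *)
have Wa s : wave_integral (fun t => t - a) p q s = 0.
  have iw1 := integrable_wave mid ip iq s.
  have iw2 := integrable_wave mid iq iNp s.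
  have -> : 0 = cos (s * a) * wave_integral id p q s +
              - sin (s * a) * wave_integral id q (fun t => - p t) s.
    by rewrite W1 W2; ring.
  rewrite /wave_integral -!RintegralZl// -RintegralD//; last 2 first.
  - exact: (integrableZl _ _ iw1).
  - exact: (integrableZl _ _ iw2).
  by apply: eq_Rintegral => t _; rewrite /wave mulrBr cosB sinB; ring.
have := @cvg_trunc_wave_integral R _ _ _ 0 mta ip iq.
rewrite (_ : (fun _ => _) = cst 0); last first.
  apply/funext => b; rewrite (@eq_trunc_integral _ _ (cst 0)).
    by rewrite /trunc_integral !Rintegral_cst// !mul0r addr0.
  by move=> s /=; rewrite Wa mul0r.
move=> c0.
have /eqP : pi * wave_integral (fun t => t - a)
  (fun t => - (Num.sg (t - a) * q t)) (fun t => Num.sg (t - a) * p t) 0 = 0.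
  rewrite -(cvg_lim (@Rhausdorff R) c0); apply: cvg_lim; first exact: Rhausdorff.
  exact: cvg_cst.
rewrite mulf_eq0 gt_eqF ?pi_gt0//= => /eqP.
have isq := integrable_sgrM mta iq.
rewrite (_ : wave_integral _ _ _ _ = -1 * \int[mu]_t (Num.sg (t - a) * q t)).
  by rewrite mulN1r => /eqP; rewrite oppr_eq0 => /eqP.
rewrite -RintegralZl//; apply: eq_Rintegral => t _.
by rewrite /wave mul0r cos0 sin0; ring.
Qed.

End injectivity.

(** * Complex-valued functions *)

Section complex_valued.
Context {R : realType}.
Notation mu := (@lebesgue_measure R).
Local Notation trunc_filter := (filter_prod (0 : R)^'+ (pinfty_nbhs R)).
Implicit Types (f g : R -> R[i]) (x : R).

Local Notation c := ((Num.sqrt (2 * pi))^-1 : R).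

Let mid : measurable_fun setT (@id R). Proof. exact: measurable_id. Qed.

Lemma cvg_complex {T : Type} (F : set_system T) (u v : T -> R) (a b : R) :
  Filter F -> u t @[t --> F] --> a -> v t @[t --> F] --> b ->
  (fun t => u t +i* v t : R[i]^o) t @[t --> F] --> (a +i* b : R[i]^o).
Proof.
(* The radius [e] lives in [R[i]]; being positive there means having zero imaginary part and
   positive real part. *)
move=> FF ua vb; apply/cvgrPdist_lt => e; rewrite ltcE/= => /andP[/eqP Ie Re].
have e20 : 0 < complex.Re e / 2 by rewrite divr_gt0.
move/cvgrPdist_lt/(_ _ e20) in ua; move/cvgrPdist_lt/(_ _ e20) in vb.
apply: filterS2 ua vb => t ut vt.
rewrite normc_def ltcE/= Ie eqxx/=.
have -> : complex.Re e = Num.sqrt (complex.Re e ^+ 2).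
  by rewrite sqrtr_sqr ger0_norm// ltW.
rewrite ltr_sqrt ?exprn_gt0//.
move: ut vt; rewrite !ltr_norml => /andP[? ?] /andP[? ?].
nra.
Qed.

(* [i sgn(t) f(t)], the multiplier by which [hilbert] acts on [fourier f]. *)
Definition sgnM f (t : R) : R[i] :=
  - (Num.sg t * complex.Im (f t)) +i* (Num.sg t * complex.Re (f t)).

Lemma sgnM_L1 f : L1 R f -> L1 R (sgnM f).
Proof.
move=> [ip iq]; split => /=; last exact: (integrable_sgrM mid ip).
exact: (integrableN (integrable_sgrM mid iq)).
Qed.

(** The imaginary part of (p + i q) exp(- i x t) is the real part for the rotated pair (q, -p). Both
    components are thus real waves, with the normalising constant absorbed into the amplitudes. *)
Lemma fourierE f x : L1 R f -> fourier f x =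
  wave_integral id (fun t => c * complex.Re (f t)) (fun t => c * complex.Im (f t)) x +i*
  wave_integral id (fun t => c * complex.Im (f t)) (fun t => - (c * complex.Re (f t))) x.
Proof.
move=> [ip iq].
have iNp : mu.-integrable setT (EFin \o (fun t => - complex.Re (f t))).
  exact: (integrableN ip).
have iw := integrable_wave mid ip iq x.
have iw' := integrable_wave mid iq iNp x.
have -> : wave_integral id (fun t => c * complex.Re (f t)) (fun t => c * complex.Im (f t)) x =
    c * \int[mu]_t complex.Re (f t * expi (- (x * t))).
  rewrite (@eq_Rintegral _ _ _ mu setT (wave id (fun t => complex.Re (f t)) (fun t => complex.Im (f t)) x)).
    by rewrite -RintegralZl//; apply: eq_Rintegral => t _; rewrite /wave; ring.
  by move=> t _; rewrite /wave/=; case: (f t) => a b; rewrite /expi/= cosN sinN /id; ring.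
have -> : wave_integral id (fun t => c * complex.Im (f t)) (fun t => - (c * complex.Re (f t))) x =
    c * \int[mu]_t complex.Im (f t * expi (- (x * t))).
  rewrite (@eq_Rintegral _ _ _ mu setT (wave id (fun t => complex.Im (f t)) (fun t => - complex.Re (f t)) x)).
    by rewrite -RintegralZl//; apply: eq_Rintegral => t _; rewrite /wave; ring.
  by move=> t _; rewrite /wave/=; case: (f t) => a b; rewrite /expi/= cosN sinN /id; ring.
by rewrite /fourier /cintegral; apply/eqP; rewrite eq_complex/=; apply/andP; split; apply/eqP; ring.
Qed.

Lemma Re_hilbert_kernel (phi : R -> R[i]) (x s : R) :
  complex.Re (hilbert_kernel phi x s) = complex.Re (phi s) / (x - s).
Proof.
rewrite /hilbert_kernel -[(x - s)%:C^-1]fmorphV/=.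
by case: (phi s) => a b /=; rewrite mulr0 subr0.
Qed.

Lemma Im_hilbert_kernel (phi : R -> R[i]) (x s : R) :
  complex.Im (hilbert_kernel phi x s) = complex.Im (phi s) / (x - s).
Proof.
rewrite /hilbert_kernel -[(x - s)%:C^-1]fmorphV/=.
by case: (phi s) => a b /=; rewrite mulr0 add0r.
Qed.

Lemma hilbert_truncE (phi : R -> R[i]) (x eps N : R) :
  hilbert_trunc phi x eps N =
  (pi^-1 * trunc_integral (fun s => complex.Re (phi s) / (x - s)) x eps N) +i*
  (pi^-1 * trunc_integral (fun s => complex.Im (phi s) / (x - s)) x eps N).
Proof.
rewrite /hilbert_trunc /cintegral /trunc_integral.
under eq_Rintegral do rewrite Re_hilbert_kernel.
under [X in _ +i* X + _]eq_Rintegral do rewrite Im_hilbert_kernel.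
under [X in _ + (X +i* _)]eq_Rintegral do rewrite Re_hilbert_kernel.
under [X in _ + (_ +i* X)]eq_Rintegral do rewrite Im_hilbert_kernel.
by apply/eqP; rewrite eq_complex/=; apply/andP; split; apply/eqP; ring.
Qed.

Section hilbert_fourier.
Variable f : R -> R[i].
Hypothesis L1f : L1 R f.

Let P (t : R) : R := c * complex.Re (f t).
Let Q (t : R) : R := c * complex.Im (f t).

Let iP : mu.-integrable setT (EFin \o P).
Proof. by case: L1f => ip _; exact: (integrableZl _ c ip). Qed.

Let iQ : mu.-integrable setT (EFin \o Q).
Proof. by case: L1f => _ iq; exact: (integrableZl _ c iq). Qed.

Let iNP : mu.-integrable setT (EFin \o (fun t => - P t)).
Proof. exact: (integrableN iP). Qed.

Let ReE s : complex.Re (fourier f s) = wave_integral id P Q s.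
Proof. by rewrite fourierE. Qed.

Let ImE s : complex.Im (fourier f s) = wave_integral id Q (fun t => - P t) s.
Proof. by rewrite fourierE. Qed.

(** The real limit is applied to (P, Q) and to (Q, -P); the factor pi it produces cancels the 1 / pi
    of the Hilbert transform. *)
Lemma cvg_hilbert_trunc_fourier x :
  hilbert_filter (fourier f) x --> (fourier (sgnM f) x : R[i]^o).
Proof.
rewrite /hilbert_filter fourierE; last exact: sgnM_L1.
under eq_fun do rewrite hilbert_truncE.
apply: cvg_complex.
- have -> : wave_integral id (fun t => c * complex.Re (sgnM f t))
      (fun t => c * complex.Im (sgnM f t)) x =
      pi^-1 * (pi * wave_integral id (fun t => - (Num.sg t * Q t)) (fun t => Num.sg t * P t) x).
    rewrite mulKf ?gt_eqF ?pi_gt0//.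
    by congr (wave_integral id _ _ x); apply/funext => t; rewrite /sgnM/= /P /Q; ring.
  apply: cvgMr.
  rewrite (_ : (fun s => complex.Re (fourier f s) / (x - s)) =
               (fun s => wave_integral id P Q s / (x - s))); last first.
    by apply/funext => s; rewrite ReE.
  exact: (@cvg_trunc_wave_integral R _ _ _ x mid iP iQ).
- have -> : wave_integral id (fun t => c * complex.Im (sgnM f t))
      (fun t => - (c * complex.Re (sgnM f t))) x =
      pi^-1 * (pi * wave_integral id (fun t => - (Num.sg t * - P t)) (fun t => Num.sg t * Q t) x).
    rewrite mulKf ?gt_eqF ?pi_gt0//.
    by congr (wave_integral id _ _ x); apply/funext => t; rewrite /sgnM/= /P /Q; ring.
  apply: cvgMr.
  rewrite (_ : (fun s => complex.Im (fourier f s) / (x - s)) =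
               (fun s => wave_integral id Q (fun t => - P t) s / (x - s))); last first.
    by apply/funext => s; rewrite ImE.
  exact: (@cvg_trunc_wave_integral R _ _ _ x mid iQ iNP).
Qed.

Lemma hilbert_exists_fourier : hilbert_exists (fourier f).
Proof.
move=> x; split; last by apply/cvg_ex; exists (fourier (sgnM f) x); exact: cvg_hilbert_trunc_fourier.
move=> eps N eps0.
have [r1 r2] := integrable_wave_kernel x N eps0 mid iP iQ.
have [i1 i2] := integrable_wave_kernel x N eps0 mid iQ iNP.
split; split.
- by apply: eq_integrable r1 => // s _; rewrite Re_hilbert_kernel ReE.
- by apply: eq_integrable i1 => // s _; rewrite Im_hilbert_kernel ImE.
- by apply: eq_integrable r2 => // s _; rewrite Re_hilbert_kernel ReE.
- by apply: eq_integrable i2 => // s _; rewrite Im_hilbert_kernel ImE.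
Qed.

Lemma hilbert_fourier : hilbert (fourier f) = fourier (sgnM f).
Proof.
apply/funext => x; rewrite /hilbert.
exact: (@cvg_lim R[i]^o (@norm_hausdorff _ _) _ _ _ _ _ (cvg_hilbert_trunc_fourier (x := x))).
Qed.

End hilbert_fourier.

End complex_valued.

(** * The Fourier image of L_1: linearity, injectivity modulo null sets, and the action of the
    Hilbert transform *)

Section fourier_space.
Context {R : realType}.
Notation mu := (@lebesgue_measure R).
Implicit Types (f g : R -> R[i]) (x : R).

Local Notation c := ((Num.sqrt (2 * pi))^-1 : R).

Let c_neq0 : c != 0.
Proof. by rewrite invr_eq0 gt_eqF// sqrtr_gt0 mulr_gt0// pi_gt0. Qed.

Let mid : measurable_fun setT (@id R). Proof. exact: measurable_id. Qed.

Let aeS (P Q : R -> Prop) : (forall t, P t -> Q t) ->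
  {ae mu, forall t, P t} -> {ae mu, forall t, Q t}.
Proof. by move=> PQ; apply: filterS; first exact: (ae_filter_ringOfSetsType mu). Qed.

Let aeS2 (P Q S : R -> Prop) : (forall t, P t -> Q t -> S t) ->
  {ae mu, forall t, P t} -> {ae mu, forall t, Q t} -> {ae mu, forall t, S t}.
Proof. by move=> PQ; apply: filterS2; first exact: (ae_filter_ringOfSetsType mu). Qed.

Lemma complex_eqP (z w : R[i]) :
  complex.Re z = complex.Re w -> complex.Im z = complex.Im w -> z = w.
Proof. by case: z w => [a b] [a' b'] /= -> ->. Qed.

Lemma ae_eq_Rintegral (p q : R -> R) :
  measurable_fun [set: R] p -> measurable_fun [set: R] q ->
  {ae mu, forall t, p t = q t} -> \int[mu]_t p t = \int[mu]_t q t.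
Proof.
move=> mp mq pq; congr fine; apply: ae_eq_integral => //.
- exact/measurable_EFinP.
- exact/measurable_EFinP.
- by apply: aeS pq => t pqt _; rewrite pqt.
Qed.

Lemma L1Z (a : R[i]) f : L1 R f -> L1 R (fun t => a * f t).
Proof.
case: a => a1 a2 [ip iq]; split.
- move: (integrable_lin a1 (- a2) ip iq); apply: eq_integrable => // t _ /=.
  by case: (f t) => u v /=; congr EFin; ring.
- move: (integrable_lin a2 a1 ip iq); apply: eq_integrable => // t _ /=.
  by case: (f t) => u v /=; congr EFin; ring.
Qed.

Lemma L1D f g : L1 R f -> L1 R g -> L1 R (fun t => f t + g t).
Proof.
move=> [ip iq] [ip' iq']; split.
- move: (integrableD measurableT ip ip'); apply: eq_integrable => // t _ /=.
  by case: (f t) (g t) => [u v] [u' v'].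
- move: (integrableD measurableT iq iq'); apply: eq_integrable => // t _ /=.
  by case: (f t) (g t) => [u v] [u' v'].
Qed.

Let L1c f : L1 R f ->
  [/\ mu.-integrable setT (EFin \o (fun t => c * complex.Re (f t))),
      mu.-integrable setT (EFin \o (fun t => c * complex.Im (f t))),
      mu.-integrable setT (EFin \o (fun t => - (c * complex.Re (f t))))
    & mu.-integrable setT (EFin \o (fun t => - (c * complex.Im (f t))))].
Proof.
move=> [ip iq]; have icp := integrableZl measurableT c ip.
have icq := integrableZl measurableT c iq.
by split; [exact: icp|exact: icq|exact: (integrableN icp)|exact: (integrableN icq)].
Qed.

Lemma fourierZ (a : R[i]) f x : L1 R f ->
  fourier (fun t => a * f t) x = a * fourier f x.
Proof.
move=> L1f; rewrite !fourierE//; last exact: L1Z.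
have [ip iq iNp iNq] := L1c L1f.
case: a => a1 a2; apply: complex_eqP => /=.
- rewrite -mulNr -(wave_integral_lin a1 (- a2) x mid ip iq iq iNp).
  by congr (wave_integral id _ _ x); apply/funext => t; case: (f t) => u v /=; ring.
- rewrite -(wave_integral_lin a1 a2 x mid iq iNp ip iq).
  by congr (wave_integral id _ _ x); apply/funext => t; case: (f t) => u v /=; ring.
Qed.

Lemma fourierD f g x : L1 R f -> L1 R g ->
  fourier (fun t => f t + g t) x = fourier f x + fourier g x.
Proof.
move=> L1f L1g; rewrite !fourierE//; last exact: L1D.
have [ip iq iNp _] := L1c L1f; have [ip' iq' iNp' _] := L1c L1g.
apply: complex_eqP => /=.
- have := wave_integral_lin 1 1 x mid ip iq ip' iq'; rewrite !mul1r => <-.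
  by congr (wave_integral id _ _ x); apply/funext => t;
    case: (f t) (g t) => [u v] [u' v'] /=; ring.
- have := wave_integral_lin 1 1 x mid iq iNp iq' iNp'; rewrite !mul1r => <-.
  by congr (wave_integral id _ _ x); apply/funext => t;
    case: (f t) (g t) => [u v] [u' v'] /=; ring.
Qed.

Lemma fourier_ae f g : L1 R f -> L1 R g -> {ae mu, forall t, f t = g t} ->
  fourier f = fourier g.
Proof.
move=> L1f L1g fg; apply/funext => x; rewrite !fourierE//.
have [ip iq iNp _] := L1c L1f; have [ip' iq' iNp' _] := L1c L1g.
have mw (p q : R -> R) : mu.-integrable setT (EFin \o p) ->
    mu.-integrable setT (EFin \o q) -> measurable_fun [set: R] (wave id p q x).
  move=> jp jq; apply/measurable_EFinP.
  exact: measurable_int (integrable_wave mid jp jq x).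
by apply: complex_eqP => /=; apply: ae_eq_Rintegral; [exact: mw|exact: mw| |
  exact: mw|exact: mw|]; apply: aeS fg => t; rewrite /wave => ->.
Qed.

Lemma fourier_inj f g : L1 R f -> L1 R g -> fourier f = fourier g ->
  {ae mu, forall t, f t = g t}.
Proof.
move=> L1f L1g fg; pose h t := f t + -1 * g t.
have L1h : L1 R h by apply: L1D => //; exact: L1Z.
have h0 x : fourier h x = 0.
  by rewrite fourierD//; [rewrite fourierZ// fg; ring|exact: L1Z].
have [ip iq iNp iNq] := L1c L1h.
have W1 x : wave_integral id (fun t => c * complex.Re (h t))
    (fun t => c * complex.Im (h t)) x = 0.
  by have := h0 x; rewrite fourierE// => /(congr1 (@complex.Re R)).
have W2 x : wave_integral id (fun t => c * complex.Im (h t))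
    (fun t => - (c * complex.Re (h t))) x = 0.
  by have := h0 x; rewrite fourierE// => /(congr1 (@complex.Im R)).
(* [wave_integral_eq0_ae] controls only the second amplitude. Its use on the rotated pair, for which
   [W3] is needed, yields the real part of [h]. *)
have W3 x : wave_integral id (fun t => - (c * complex.Re (h t)))
    (fun t => - (c * complex.Im (h t))) x = 0.
  have := wave_integral_lin (-1) 0 x mid ip iq ip iq.
  rewrite W1 !mulr0 addr0 => <-.
  by congr (wave_integral id _ _ x); apply/funext => t; ring.
have Imh := wave_integral_eq0_ae ip iq W1 W2.
have Reh := wave_integral_eq0_ae iq iNp W2 W3.
apply: aeS2 Imh Reh => t /eqP; rewrite mulf_eq0 (negbTE c_neq0)/= => /eqP.
move=> It /eqP; rewrite oppr_eq0 mulf_eq0 (negbTE c_neq0)/= => /eqP Rt.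
have : h t = 0 by exact: complex_eqP.
by rewrite /h mulN1r => /eqP; rewrite subr_eq0 => /eqP.
Qed.

Lemma measurable_normc f : L1 R f ->
  measurable_fun [set: R] (fun t => Normc.normc (f t)).
Proof.
move=> [/measurable_int/measurable_EFinP mp /measurable_int/measurable_EFinP mq].
rewrite (_ : (fun _ => _) = Num.sqrt \o
  (fun t => complex.Re (f t) ^+ 2 + complex.Im (f t) ^+ 2)); last first.
  by apply/funext => t; rewrite /=; case: (f t).
apply: (measurableT_comp (continuous_measurable_fun (@sqrt_continuous R))).
by apply: measurable_funD; exact: measurable_funX.
Qed.

Lemma L1norm_ae f g : L1 R f -> L1 R g ->
  {ae mu, forall t, Normc.normc (f t) = Normc.normc (g t)} ->
  L1norm f = L1norm g.
Proof.
by move=> L1f L1g fg; apply: ae_eq_Rintegral => //; exact: measurable_normc.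
Qed.

Lemma ae_neq0 : {ae mu, forall t : R, t != 0}.
Proof.
exists [set 0]; split; [exact: measurable_set1|exact: lebesgue_measure_set1|].
by move=> t /= /negP; rewrite negbK => /eqP.
Qed.

Lemma sgnM_gt0 f (t : R) : 0 < t -> sgnM f t = 'i * f t.
Proof.
by move=> t0; rewrite /sgnM gtr0_sg//; apply: complex_eqP => /=; case: (f t) => u v /=; ring.
Qed.

Lemma sgnM_lt0 f (t : R) : t < 0 -> sgnM f t = - 'i * f t.
Proof.
by move=> t0; rewrite /sgnM ltr0_sg//; apply: complex_eqP => /=; case: (f t) => u v /=; ring.
Qed.

(** The square of i sgn t is -1 except at t = 0, where the multiplier is 0. *)
Lemma sgnMK f : {ae mu, forall t, sgnM (sgnM f) t = -1 * f t}.
Proof.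
apply: aeS ae_neq0 => t; rewrite neq_lt => /orP[t0|t0]; rewrite /sgnM.
  by rewrite ltr0_sg//; apply: complex_eqP => /=; case: (f t) => u v /=; ring.
by rewrite gtr0_sg//; apply: complex_eqP => /=; case: (f t) => u v /=; ring.
Qed.

Lemma normc_sgnM f : {ae mu, forall t, Normc.normc (sgnM f t) = Normc.normc (f t)}.
Proof.
apply: aeS ae_neq0 => t; rewrite neq_lt => /orP[t0|t0]; rewrite /sgnM.
  by rewrite ltr0_sg//; case: (f t) => u v /=; congr Num.sqrt; ring.
by rewrite gtr0_sg//; case: (f t) => u v /=; congr Num.sqrt; ring.
Qed.

Lemma sgnM_lin (a b : R[i]) f g :
  sgnM (fun t => a * f t + b * g t) = (fun t => a * sgnM f t + b * sgnM g t).
Proof.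
apply/funext => t; apply: complex_eqP; rewrite /sgnM;
  case: (f t) (g t) a b => [u v] [u' v'] [a1 a2] [b1 b2] /=; ring.
Qed.

Lemma FR_fourier f : L1 R f -> FR R (fourier f).
Proof. by exists f. Qed.

Lemma FRnormP (phi : R -> R[i]) : FR R phi ->
  exists f, [/\ L1 R f, fourier f = phi & FRnorm phi = c * L1norm f].
Proof.
move=> [f L1f fphi].
pose f0 := xget (fun=> 0) [set f | L1 R f /\ fourier f = phi].
have [L1f0 f0phi] : [set f | L1 R f /\ fourier f = phi] f0.
  by apply: xgetPex; exists f.
by exists f0.
Qed.

Lemma hilbert_FR : hilbert @` FR R = FR R.
Proof.
apply/seteqP; split => phi.
  move=> [_ [f L1f <-] <-]; rewrite hilbert_fourier//.
  exact/FR_fourier/sgnM_L1.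
(* Almost everywhere the inverse of the multiplier i sgn t is - i sgn t. *)
move=> [f L1f <-]; exists (fourier (fun t => -1 * sgnM f t)).
  by apply/FR_fourier/L1Z/sgnM_L1.
have L1g : L1 R (fun t => -1 * sgnM f t) by apply/L1Z/sgnM_L1.
rewrite hilbert_fourier//; apply: fourier_ae => //; first exact: sgnM_L1.
have := sgnM_lin (-1) 0 (sgnM f) (sgnM f) => sl.
apply: aeS (sgnMK f) => t st.
have := congr1 (@^~ t) sl; rewrite /= mul0r addr0 st mulN1r mulN1r opprK => <-.
by congr sgnM; apply/funext => s; rewrite mul0r addr0.
Qed.

Lemma isometric_hilbert : isometric_operator (R := R) hilbert.
Proof.
split=> [a b _ _ [f L1f <-] [g L1g <-]|phi Fphi].
  have La := L1Z a L1f; have Lb := L1Z b L1g.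
  have -> : (fun x => a * fourier f x + b * fourier g x) =
            fourier (fun t => a * f t + b * g t).
    by apply/funext => x; rewrite fourierD// !fourierZ.
  rewrite !hilbert_fourier//; last exact: L1D.
  have Lsf := sgnM_L1 L1f; have Lsg := sgnM_L1 L1g.
  rewrite sgnM_lin; apply/funext => x.
  by rewrite fourierD ?fourierZ//; exact: L1Z.
have [f [L1f <- ->]] := FRnormP Fphi.
rewrite hilbert_fourier//.
(* The norm of the image is computed on some chosen [g], known only to have the same transform as
   [sgnM f]. Injectivity makes the two equal almost everywhere, and the multiplier preserves the
   modulus off the origin. *)
have [g [L1g gE ->]] := FRnormP (FR_fourier (sgnM_L1 L1f)).
congr (_ * _); apply: L1norm_ae => //.
apply: aeS2 (fourier_inj L1g (sgnM_L1 L1f) gE) (normc_sgnM f) => t -> //.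
Qed.

Lemma half_line_eigenfunction f : L1 R f ->
  {ae mu, forall t, t < 0 -> f t = 0} \/ {ae mu, forall t, 0 < t -> f t = 0} ->
  hilbert_eigenfunction (fourier f).
Proof.
move=> L1f f0; split; first exact: hilbert_exists_fourier.
suff [l fl] : exists l : R[i], {ae mu, forall t, sgnM f t = l * f t}.
  exists l => x; rewrite hilbert_fourier// -fourierZ//.
  by rewrite (fourier_ae (sgnM_L1 L1f) (L1Z l L1f) fl).
have sgn0 t : f t = 0 -> sgnM f t = 0.
  by move=> ft; rewrite /sgnM ft; apply: complex_eqP => /=; ring.
(* The eigenvalue is the value of i sgn t on the half-axis that may carry [f]; on the other one both
   sides vanish. *)
case: f0 => f0; [exists 'i|exists (- 'i)]; apply: aeS2 ae_neq0 f0 => t.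
  rewrite neq_lt => /orP[t0 /(_ t0) ft|t0 _]; last exact: sgnM_gt0.
  by rewrite sgn0// ft mulr0.
rewrite neq_lt => /orP[t0 _|t0 /(_ t0) ft]; first exact: sgnM_lt0.
by rewrite sgn0// ft mulr0.
Qed.

Lemma FR_eigenfunction_sum (phi : R -> R[i]) : FR R phi ->
  exists phi1 phi2 : R -> R[i],
    [/\ FR R phi1, hilbert_eigenfunction phi1,
        FR R phi2, hilbert_eigenfunction phi2
      & forall x, phi x = phi1 x + phi2 x].
Proof.
move=> [f L1f <-].
(* The two pieces partition the line, with the origin in [g true], so they add up to [f] at every
   point and the decomposition is an exact equality. *)
pose g (b : bool) (t : R) : R[i] := if (t \in `[0, +oo[) == b then f t else 0.
have L1g b : L1 R (g b).
  have mD : measurable [set t : R | (t \in `[0, +oo[) = b].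
    have m0y : measurable (`[0, +oo[ : set R) by exact: measurable_itv.
    case: b; first exact: m0y.
    rewrite (_ : mkset _ = ~` (`[0, +oo[ : set R)); first exact: measurableC.
    by apply/seteqP; split => t /=; [move=> ->|move/negP/negbTE].
  case: L1f => ip iq; split.
    have : mu.-integrable [set t : R | (t \in `[0, +oo[) = b]
        (fun t => (complex.Re (f t))%:E) by exact: integrableS ip.
    rewrite integrable_mkcond//; apply: eq_integrable => // t _.
    by rewrite patchE /g; case: eqP => tb; [rewrite mem_set|rewrite memNset].
  have : mu.-integrable [set t : R | (t \in `[0, +oo[) = b]
        (fun t => (complex.Im (f t))%:E) by exact: integrableS iq.
  rewrite integrable_mkcond//; apply: eq_integrable => // t _.
  by rewrite patchE /g; case: eqP => tb; [rewrite mem_set|rewrite memNset].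
exists (fourier (g true)), (fourier (g false)); split.
- exact: FR_fourier.
- apply: half_line_eigenfunction => //; left; apply: aeW => t t0.
  by rewrite /g in_itv/= leNgt t0.
- exact: FR_fourier.
- apply: half_line_eigenfunction => //; right; apply: aeW => t t0.
  by rewrite /g in_itv/= (ltW t0).
- move=> x; rewrite -fourierD//; congr fourier; apply/funext => t.
  by rewrite /g; case: (t \in `[0, +oo[); rewrite /= ?addr0 ?add0r.
Qed.

End fourier_space.

Theorem mainTheorem9 (R : realType) :
  [/\ (forall phi : R -> R[i], FR R phi -> hilbert_exists phi) /\
        hilbert @` FR R = FR R,
      isometric_operator (R := R) hilbert,
      (forall f : R -> R[i], L1 R f ->
         {ae @lebesgue_measure R, forall t, t < 0 -> f t = 0} \/
         {ae @lebesgue_measure R, forall t, 0 < t -> f t = 0} ->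
         hilbert_eigenfunction (fourier f))
    & (forall phi : R -> R[i], FR R phi ->
         exists phi1 phi2 : R -> R[i],
           [/\ FR R phi1, hilbert_eigenfunction phi1,
               FR R phi2, hilbert_eigenfunction phi2
             & forall x, phi x = phi1 x + phi2 x])].
Proof.
split.
- split; last exact: hilbert_FR.
  by move=> _ [f L1f <-]; exact: hilbert_exists_fourier.
- exact: isometric_hilbert.
- exact: half_line_eigenfunction.
- exact: FR_eigenfunction_sum.
Qed.
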